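(* For every $(x_1,x_2)\in H^2(Cay)$, every $y\in Im(Cay)$ and every $z\in Cay$, we have $u(y,z)(x_1,x_2)=(x'_1,x'_2)$, where $$x'_1= \Big[\Big(\big(1-\tfrac{|z|^2}{2}-y\big)x_1+ \big(\overline{z}(x_2(1-\overline{x_1}))\big)(1-\overline{x_1})^{-1}+ \tfrac{|z|^2}{2}+y\Big)(1-\overline{x_1})\Big]\cdot D^{-1},$$ $$x'_2= \big[(-zx_1+x_2+z)(1-\overline{x_1})\big]\cdot D^{-1},$$ and $$D=\Big[-\big(\tfrac{|z|^2}{2}+y\big)x_1 + \big(\overline{z}(x_2(1-\overline{x_1}))\big)(1-\overline{x_1})^{-1} +1+\tfrac{|z|^2}{2}+y\Big](1-\overline{x_1}).$$
   Context: **Octonions.** $Cay$ is the 8-dimensional non-associative (alternative) real division algebra with basis $e_0=1,e_1,\dots,e_7$ and relations: $e_0e_i=e_ie_0=e_i$ for all $i$; $e_i^2=-e_0$ for $i>0$; $e_ie_j=-e_je_i$ for $i,j>0$, $i\ne j$; $e_2e_6=e_3e_4=e_5e_7=e_1$ together with all relations deduced from these by cyclic permutations of the indices $1,2,\dots,7$. For $x=a+\sum_{i=1}^7 b_ie_i$: conjugate $\overline{x}=a-\sum_{i=1}^7 b_ie_i$, norm $N(x)=x\overline{x}=a^2+\sum b_i^2$, modulus $|x|=\sqrt{N(x)}$, imaginary part $Im(x)=\frac{x-\overline{x}}{2}$, inverse $x^{-1}=\overline{x}/N(x)$ for $x\neq 0$. $Im(Cay)=\{x\in Cay: x=Im(x)\}$.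 Real numbers are identified with multiples of $1$. **Projective plane.** $P^2(Cay)$ is the disjoint union of $Cay\times Cay$ (points at finite distance) and the set of points at infinity $\{(u):u\in Cay\cup\{\infty\}\}$. Its lines are: $[u,v]=\{(x,y)\in Cay\times Cay:y=ux+v\}\cup\{(u)\}$ for $u,v\in Cay$; $[u]=\{(x,y)\in Cay\times Cay:x=u\}\cup\{(\infty)\}$ for $u\in Cay$; and $[\infty]$, the set of all points at infinity. A collineation is a bijection of $P^2(Cay)$ onto itself preserving the set of lines. **Polarity and hyperbolic plane.** A polarity is a bijection $\Pi$ from points to lines such that, if $a$ runs through a line, then $\Pi(a)$ runs in the sheaf of lines through a given point, and $a\in\Pi(b)\Leftrightarrow b\in\Pi(a)$; it acts on lines by sending a line $L$ to the common point of the lines $\Pi(a)$, $a\in L$. Let $\Pi$ be the polarity of $P^2(Cay)$ given by $\Pi(x,y)=[-\overline{xy^{-1}},\overline{y^{-1}}]$ if $y\ne0$, $\Pi(x,0)=[\overline{x^{-1}}]$ if $x\neq0$, $\Pi(0,0)=[\infty]$ (its values at points at infinity are then forced: $\Pi((\infty))=[0,0]$, $\Pi((0))=[0]$, $\Pi((u))=[-\overline{u^{-1}},0]$ for $u\in Cay\setminus\{0\}$). The hyperbolic plane is $H^2(Cay)=\{(x_1,x_2)\in Cay\times Cay:|x_1|^2+|x_2|^2<1\}$. Let $G$ be its automorphism group, i.e. the group of collineations of $P^2(Cay)$ commuting with $\Pi$; it is a simple Lie group isomorphic to $F_{4(-20)}$ and it acts on $H^2(Cay)$. **The groups $A$ and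 $N$.** For $t\in\mathbb{R}$, $a_t\in G$ is the element acting on $H^2(Cay)$ by $$a_t(x_1,x_2)= \big((\cosh(t)x_1 + \sinh(t))(\sinh(t)x_1+\cosh(t))^{-1},\ x_2(\sinh(t)x_1+\cosh(t))^{-1}\big).$$ $A=\{a_t:t\in\mathbb{R}\}$ is the split one-parameter group in an Iwasawa decomposition $G=KAN$, where $K$ is the stabilizer of $(0,0)$ in $G$. Write $a_t=\exp(tX)$ with $X$ in the Lie algebra $\mathfrak{g}$ of $G$. Let $\mathfrak{g}_\alpha,\mathfrak{g}_{2\alpha}\subset\mathfrak{g}$ be the eigenspaces of $\mathrm{ad}(X)$ for the eigenvalues $1$ and $2$ (of real dimensions 8 and 7), and $N=\exp(\mathfrak{g}_\alpha\oplus\mathfrak{g}_{2\alpha})$, a 2-step nilpotent group of dimension 15. The group $AN$ acts simply transitively on $H^2(Cay)$. **The elements $u(y,z)$.** There are linear parametrizations $\mathfrak{g}_\alpha=\{Z(z):z\in Cay\}$, $\mathfrak{g}_{2\alpha}=\{Y(y):y\in Im(Cay)\}$ (due to Takahashi), and one sets $u(y,z)=\exp(Y(y)+Z(z))=\exp(Y(y))\exp(Z(z))$, so that $N=\{u(y,z):y\in Im(Cay),z\in Cay\}$ and the centre of $N$ is $Z(N)=\{u(y,0):y\in Im(Cay)\}$. With this parametrization, $u(y,z)$ is the unique element of $N$ such that $$u(y,z)(0,0)=\Big(\big(\tfrac{|z|^2}{2}+y\big)\big(1+\tfrac{|z|^2}{2}+y\big)^{-1},\ z\big(1+\tfrac{|z|^2}{2}+y\big)^{-1}\Big).$$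 *)

(* Defs.v *)
From HB Require Import structures.
From mathcomp Require Import all_boot all_order all_algebra.
From mathcomp Require Import all_classical all_reals all_analysis.
Set Implicit Arguments.
Unset Strict Implicit.
Unset Printing Implicit Defensive.
Import Order.TTheory GRing.Theory Num.Theory.
Import numFieldNormedType.Exports.
Local Open Scope classical_set_scope.
Local Open Scope ring_scope.

Declare Scope cay_scope.
Delimit Scope cay_scope with cay.

(** * Octonions *)

(* The real vector space R^8; coordinate i is the coefficient of e_i.  Its
   normed space structure is used for derivatives only: the matrix norm is the
   sup norm, and the modulus of an octonion is [caymod] below. *)
Notation cay R := (matrix R 1 8).

(* The representative in {1, ..., 7} of n modulo 7, for n > 0. *)
Definition cyc (n : nat) : nat := (n.-1 %% 7).+1.

(* e_i e_j = e_k is one of the relations e_2 e_6 = e_3 e_4 = e_5 e_7 = e_1 or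
   is obtained from one of them by a cyclic permutation of 1, ..., 7. *)
Definition cay_rel (i j k : nat) : bool :=
  has (fun c => (i, j, k) \in
         [:: (cyc (2 + c), cyc (6 + c), cyc (1 + c));
             (cyc (3 + c), cyc (4 + c), cyc (1 + c));
             (cyc (5 + c), cyc (7 + c), cyc (1 + c))]%N) (iota 0 7).

(* The coefficient of e_k in e_i e_j. *)
Definition cay_coef (R : realType) (i j k : nat) : R :=
  if i == 0%N then (j == k)%:R
  else if j == 0%N then (i == k)%:R
  else if i == j then - (k == 0%N)%:R
  else (cay_rel i j k)%:R - (cay_rel j i k)%:R.

Definition caymul (R : realType) (x y : cay R) : cay R :=
  \row_(k < 8) \sum_(i < 8) \sum_(j < 8) cay_coef R i j k * x ord0 i * y ord0 j.

Notation "x *o y" := (caymul x y) (at level 40, left associativity) : cay_scope.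

Definition cayreal (R : realType) (a : R) : cay R := a *: delta_mx ord0 ord0.

Notation "a %:O" := (cayreal a) (at level 1, left associativity, format "a %:O")
  : cay_scope.

Local Open Scope cay_scope.

Definition cayconj (R : realType) (x : cay R) : cay R :=
  \row_(i < 8) (if i == ord0 then x ord0 i else - x ord0 i).

Definition caynorm (R : realType) (x : cay R) : R := \sum_i x ord0 i ^+ 2.

Definition caymod (R : realType) (x : cay R) : R := Num.sqrt (caynorm x).

Definition cayim (R : realType) (x : cay R) : cay R := 2^-1 *: (x - cayconj x).

Definition imcay (R : realType) : set (cay R) := [set x | x = cayim x].

Definition cayinv (R : realType) (x : cay R) : cay R := (caynorm x)^-1 *: cayconj x.

(** * The projective plane *)

Inductive plane (R : realType) : Type :=
  | PFin of cay R & cay R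
  | PInf of cay R
  | PInfty.
Arguments PInfty {R}.

HB.instance Definition _ (R : realType) := gen_eqMixin (plane R).
HB.instance Definition _ (R : realType) := gen_choiceMixin (plane R).

(* The lines [u, v], [u] and [oo], as sets of points. *)
Definition line2 (R : realType) (u v : cay R) : set (plane R) :=
  [set p | match p with
           | PFin x y => y = u *o x + v
           | PInf w => w = u
           | PInfty => False
           end].

Definition line1 (R : realType) (u : cay R) : set (plane R) :=
  [set p | match p with
           | PFin x _ => x = u
           | PInf _ => False
           | PInfty => True
           end].

Definition line_infty (R : realType) : set (plane R) :=
  [set p | match p with
           | PFin _ _ => False
           | _ => True
           end].

Definition is_line (R : realType) (L : set (plane R)) : Prop :=
  [\/ exists u v, L = line2 u v, exists u, L = line1 u | L = @line_infty R].

Definition collineation (R : realType) (g : plane R -> plane R) : Prop :=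
  bijective g /\ forall L : set (plane R), is_line (g @` L) <-> is_line L.

Definition polarity (R : realType) (p : plane R) : set (plane R) :=
  match p with
  | PFin x y =>
      if y != 0 then line2 (- cayconj (x *o cayinv y)) (cayconj (cayinv y))
      else if x != 0 then line1 (cayconj (cayinv x))
      else @line_infty R
  | PInf u => if u != 0 then line2 (- cayconj (cayinv u)) 0 else line1 0
  | PInfty => line2 0 0
  end.

(** * The hyperbolic plane and its automorphism group *)

Definition hplane (R : realType) : set (cay R * cay R) :=
  [set p | caymod p.1 ^+ 2 + caymod p.2 ^+ 2 < 1].

(* Commuting with the polarity on points implies commuting with its action on
   lines, which is determined by its action on points. *)
Definition autG (R : realType) : set (plane R -> plane R) :=
  [set g | collineation g /\ forall p, g @` polarity p = polarity (g p)].

(** * The Lie algebra of G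
   The action of G on the hyperbolic plane is faithful, so that the Lie algebra
   of G is realized by the vector fields on this open subset of R^16 that
   generate one-parameter subgroups of G: the element v of the Lie algebra is
   the field V(p) = d/ds exp(sv)(p) at s = 0.  Fields are total functions of
   which only the values on [hplane] matter. *)

(* Affine coordinates; the value at infinity is irrelevant, as G preserves the
   hyperbolic plane. *)
Definition coords (R : realType) (p : plane R) : cay R * cay R :=
  match p with PFin x y => (x, y) | _ => (0, 0) end.

Definition one_param_subgroup (R : realType)
    (f : R -> plane R -> plane R) : Prop :=
  (forall s, autG (f s)) /\ (forall s t, f (s + t) = f s \o f t).

Definition generator (R : realType) (f : R -> plane R -> plane R)
    (V : cay R * cay R -> cay R * cay R) : Prop :=
  forall p, hplane p ->
    is_derive (0 : R) (1 : R) (fun s => coords (f s (PFin p.1 p.2))) (V p).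

Definition lieG (R : realType) : set (cay R * cay R -> cay R * cay R) :=
  [set V | (exists2 f, one_param_subgroup f & generator f V) /\
           forall p, hplane p -> differentiable V p].

(* g = exp V *)
Definition is_exp (R : realType) (V : cay R * cay R -> cay R * cay R)
    (g : plane R -> plane R) : Prop :=
  exists f, [/\ one_param_subgroup f, generator f V & f 1 = g].

(* ad(V)(W) = d/dt Ad(exp(tV))(W) at t = 0.  For a left action,
   v |-> V reverses brackets: ad(V)(W) is the opposite of the usual commutator
   (D_V W - D_W V) of the vector fields V and W. *)
Definition ad (R : realType) (V W : cay R * cay R -> cay R * cay R)
    (p : cay R * cay R) : cay R * cay R :=
  'D_(W p) V p - 'D_(V p) W p.

(** * The groups A and N *)

Definition cosh (R : realType) (t : R) : R := (expR t + expR (- t)) / 2.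
Definition sinh (R : realType) (t : R) : R := (expR t - expR (- t)) / 2.

(* The action of a_t on the hyperbolic plane. *)
Definition a_act (R : realType) (t : R) (p : cay R * cay R) : cay R * cay R :=
  let d := cayinv (sinh t *: p.1 + (cosh t)%:O) in
  ((cosh t *: p.1 + (sinh t)%:O) *o d, p.2 *o d).

(* The element X of the Lie algebra such that a_t = exp(tX). *)
Definition fieldX (R : realType) (p : cay R * cay R) : cay R * cay R :=
  derive1 (fun t : R => a_act t p) 0.

(* The eigenspace of ad(X) for the eigenvalue c. *)
Definition root_space (R : realType) (c : R) :
    set (cay R * cay R -> cay R * cay R) :=
  [set V | lieG V /\ forall p, hplane p -> ad (@fieldX R) V p = c *: V p].

Definition groupN (R : realType) : set (plane R -> plane R) :=
  [set g | exists V W, [/\ root_space 1 V, root_space 2 W &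
                           is_exp (fun p => V p + W p) g]].

(** * The elements u(y, z) *)

Definition u_origin (R : realType) (y z : cay R) : plane R :=
  let q := (caymod z ^+ 2 / 2)%:O + y in
  PFin (q *o cayinv (1%:O + q)) (z *o cayinv (1%:O + q)).

(* For y in Im(Cay), the unique element of N mapping (0, 0) to [u_origin y z];
   the default value [id] only serves to make the definition total. *)
Definition uN (R : realType) (y z : cay R) : plane R -> plane R :=
  xget (id : plane R -> plane R)
    [set g | groupN g /\ g (PFin 0 0) = u_origin y z].

(* Main.v *)
(* The Cayley transform X = x2 (1 - x1)^-1, Y = (1 + x1) (1 - x1)^-1 carries the
   hyperbolic plane to the Siegel domain Re Y > |X|^2, a_t to the dilation
   (e^t X, e^(2t) Y) and the polarity to (X, Y) |-> [2 X^*, - Y^*], where ^* is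
   the conjugation.  There the Heisenberg translations
     (X, Y) |-> (X + z, Y + 2 z^* X + |z|^2 + 2 y)
   are affine collineations commuting with the polarity; transported back, they
   are given by the formula of the theorem, and they belong to N.

   Conversely, let V be a root vector for the eigenvalue k, with components
   (A, B) in this chart.  The equation ad(X) V = k V makes A homogeneous of
   degree 1 - k under the dilations.  As the flow of V maps points of a vertical
   line to collinear points, A is affine in Y along vertical lines; homogeneity
   and continuity at X = 0 then force A to be a constant z, with z = 0 if k > 1.
   Every non-vertical line passes through the pole of a vertical line;
   differentiating this incidence gives B = 2 z^* X + const.  The flow of V + W
   is thus a Heisenberg translation, determined by the image of the origin. *)

Require Import Defs.
From mathcomp Require Import all_boot all_order all_algebra.
From mathcomp Require Import all_classical all_reals all_analysis.
From mathcomp Require Import ring lra.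
Set Implicit Arguments.
Unset Strict Implicit.
Unset Printing Implicit Defensive.
Import Order.TTheory GRing.Theory Num.Theory.
Import numFieldNormedType.Exports.
Local Open Scope classical_set_scope.
Local Open Scope ring_scope.
Local Open Scope cay_scope.

(** * Octonions *)

Section Octonions.
Variable R : realType.
Implicit Types (x y z u v w : cay R) (k l a b : R).

(** Eight explicit coordinates turn an octonion identity into polynomial identities over [R], which
    [ring] decides. *)
Definition octonion (a0 a1 a2 a3 a4 a5 a6 a7 : R) : cay R :=
  \row_i nth 0 [:: a0; a1; a2; a3; a4; a5; a6; a7] i.

Lemma octonionE x : exists a0 a1 a2 a3 a4 a5 a6 a7,
  x = octonion a0 a1 a2 a3 a4 a5 a6 a7.
Proof.
pose e (i : nat) (h : (i < 8)%N) := x ord0 (Ordinal h).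
exists (e 0 isT), (e 1 isT), (e 2 isT), (e 3 isT), (e 4 isT), (e 5 isT),
  (e 6 isT), (e 7 isT).
apply/rowP => i; rewrite mxE.
by case: i => [[|[|[|[|[|[|[|[|//]]]]]]]] h];
  rewrite /e /=; congr (x _ _); apply: val_inj.
Qed.

Lemma caymul_octonion a0 a1 a2 a3 a4 a5 a6 a7 b0 b1 b2 b3 b4 b5 b6 b7 :
  octonion a0 a1 a2 a3 a4 a5 a6 a7 *o octonion b0 b1 b2 b3 b4 b5 b6 b7 =
  octonion
    (a0 * b0 - a1 * b1 - a2 * b2 - a3 * b3 - a4 * b4 - a5 * b5 - a6 * b6 - a7 * b7)
    (a0 * b1 + a1 * b0 + a2 * b6 + a3 * b4 - a4 * b3 + a5 * b7 - a6 * b2 - a7 * b5)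
    (a0 * b2 - a1 * b6 + a2 * b0 + a3 * b7 + a4 * b5 - a5 * b4 + a6 * b1 - a7 * b3)
    (a0 * b3 - a1 * b4 - a2 * b7 + a3 * b0 + a4 * b1 + a5 * b6 - a6 * b5 + a7 * b2)
    (a0 * b4 + a1 * b3 - a2 * b5 - a3 * b1 + a4 * b0 + a5 * b2 + a6 * b7 - a7 * b6)
    (a0 * b5 - a1 * b7 + a2 * b4 - a3 * b6 - a4 * b2 + a5 * b0 + a6 * b3 + a7 * b1)
    (a0 * b6 + a1 * b2 - a2 * b1 + a3 * b5 - a4 * b7 - a5 * b3 + a6 * b0 + a7 * b4)
    (a0 * b7 + a1 * b5 + a2 * b3 - a3 * b2 + a4 * b6 - a5 * b1 - a6 * b4 + a7 *
        b0).
Proof.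
apply/rowP => i; rewrite !mxE !big_ord_recl !big_ord0 !mxE /=.
by case: i => [[|[|[|[|[|[|[|[|//]]]]]]]] h]; rewrite /cay_coef /=; ring.
Qed.

Lemma octonionD a0 a1 a2 a3 a4 a5 a6 a7 b0 b1 b2 b3 b4 b5 b6 b7 :
  octonion a0 a1 a2 a3 a4 a5 a6 a7 + octonion b0 b1 b2 b3 b4 b5 b6 b7 =
  octonion (a0 + b0) (a1 + b1) (a2 + b2) (a3 + b3)
           (a4 + b4) (a5 + b5) (a6 + b6) (a7 + b7).
Proof.
by apply/rowP => -[[|[|[|[|[|[|[|[|//]]]]]]]] h]; rewrite !mxE.
Qed.

Lemma octonionZ k a0 a1 a2 a3 a4 a5 a6 a7 :
  k *: octonion a0 a1 a2 a3 a4 a5 a6 a7 =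
  octonion (k * a0) (k * a1) (k * a2) (k * a3)
           (k * a4) (k * a5) (k * a6) (k * a7).
Proof.
by apply/rowP => -[[|[|[|[|[|[|[|[|//]]]]]]]] h]; rewrite !mxE.
Qed.

Lemma octonionN a0 a1 a2 a3 a4 a5 a6 a7 :
  - octonion a0 a1 a2 a3 a4 a5 a6 a7 =
  octonion (- a0) (- a1) (- a2) (- a3) (- a4) (- a5) (- a6) (- a7).
Proof.
by apply/rowP => -[[|[|[|[|[|[|[|[|//]]]]]]]] h]; rewrite !mxE.
Qed.

Lemma cayreal_octonion k : k%:O = octonion k 0 0 0 0 0 0 0.
Proof.
by apply/rowP => -[[|[|[|[|[|[|[|[|//]]]]]]]] h];
  rewrite !mxE /= ?mulr1 ?mulr0.
Qed.

Lemma cayconj_octonion a0 a1 a2 a3 a4 a5 a6 a7 :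
  cayconj (octonion a0 a1 a2 a3 a4 a5 a6 a7) =
  octonion a0 (- a1) (- a2) (- a3) (- a4) (- a5) (- a6) (- a7).
Proof.
by apply/rowP => -[[|[|[|[|[|[|[|[|//]]]]]]]] h]; rewrite !mxE.
Qed.

Lemma caynorm_octonion a0 a1 a2 a3 a4 a5 a6 a7 :
  caynorm (octonion a0 a1 a2 a3 a4 a5 a6 a7) =
  a0 ^+ 2 + a1 ^+ 2 + a2 ^+ 2 + a3 ^+ 2 + a4 ^+ 2 + a5 ^+ 2 + a6 ^+ 2 + a7 ^+ 2.
Proof. by rewrite /caynorm !big_ord_recl big_ord0 !mxE /=; ring. Qed.

Lemma octonion_re a0 a1 a2 a3 a4 a5 a6 a7 :
  octonion a0 a1 a2 a3 a4 a5 a6 a7 ord0 ord0 = a0.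
Proof. by rewrite mxE. Qed.

Definition octonion_ops := (caymul_octonion, octonionD, octonionZ, octonionN,
  cayreal_octonion, cayconj_octonion, caynorm_octonion, octonion_re).

End Octonions.
Arguments octonion_ops : clear implicits.

Ltac octo x := let H := fresh in
  have H := octonionE x;
  let a0 := fresh "a" in let a1 := fresh "a" in
  let a2 := fresh "a" in let a3 := fresh "a" in
  let a4 := fresh "a" in let a5 := fresh "a" in
  let a6 := fresh "a" in let a7 := fresh "a" in
  case: H => a0 [a1 [a2 [a3 [a4 [a5 [a6 [a7 ->]]]]]]].

(** * Alternativity, Moufang identities, conjugation, norm and inverses *)

Section OctonionIdentities.
Variable R : realType.
Implicit Types (x y z u v w : cay R) (k l a b : R).

Lemma caymulDl x y z : (x + y) *o z = x *o z + y *o z.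
Proof.
apply/rowP => k; rewrite !mxE -big_split; apply: eq_bigr => i _.
by rewrite -big_split; apply: eq_bigr => j _; rewrite !mxE /=; ring.
Qed.

Lemma caymulDr z x y : z *o (x + y) = z *o x + z *o y.
Proof.
apply/rowP => k; rewrite !mxE -big_split; apply: eq_bigr => i _.
by rewrite -big_split; apply: eq_bigr => j _; rewrite !mxE /=; ring.
Qed.

Lemma caymulZl k x y : (k *: x) *o y = k *: (x *o y).
Proof.
apply/rowP => l; rewrite !mxE big_distrr; apply: eq_bigr => i _.
by rewrite big_distrr; apply: eq_bigr => j _; rewrite !mxE /=; ring.
Qed.

Lemma caymulZr k x y : x *o (k *: y) = k *: (x *o y).
Proof.
apply/rowP => l; rewrite !mxE big_distrr; apply: eq_bigr => i _.
by rewrite big_distrr; apply: eq_bigr => j _; rewrite !mxE /=; ring.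
Qed.

Lemma caymulNl x y : (- x) *o y = - (x *o y).
Proof. by rewrite -scaleN1r caymulZl scaleN1r. Qed.

Lemma caymulNr x y : x *o (- y) = - (x *o y).
Proof. by rewrite -scaleN1r caymulZr scaleN1r. Qed.

Lemma caymul0l y : 0 *o y = 0.
Proof. by apply: (addrI (0 *o y)); rewrite -caymulDl !addr0. Qed.

Lemma caymul0r x : x *o 0 = 0.
Proof. by apply: (addrI (x *o 0)); rewrite -caymulDr !addr0. Qed.

Lemma cayaltl x y : x *o (x *o y) = (x *o x) *o y.
Proof. by octo x; octo y; rewrite !(octonion_ops R); congr octonion; ring. Qed.

Lemma cayaltr x y : (y *o x) *o x = y *o (x *o x).
Proof. by octo x; octo y; rewrite !(octonion_ops R); congr octonion; ring. Qed.

Lemma cayflex x y : (x *o y) *o x = x *o (y *o x).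
Proof. by octo x; octo y; rewrite !(octonion_ops R); congr octonion; ring. Qed.

Lemma caymoufang x y z : (x *o y) *o (z *o x) = (x *o (y *o z)) *o x.
Proof.
by octo x; octo y; octo z; rewrite !(octonion_ops R); congr octonion; ring.
Qed.

Lemma caymoufangr x y z : ((z *o x) *o y) *o x = z *o ((x *o y) *o x).
Proof.
by octo x; octo y; octo z; rewrite !(octonion_ops R); congr octonion; ring.
Qed.

(** The associator of an alternative algebra is alternating, hence invariant under cyclic
    permutations. *)
Lemma cayassoc_cyclic x y z :
  (x *o y) *o z - x *o (y *o z) = (y *o z) *o x - y *o (z *o x).
Proof.
by octo x; octo y; octo z; rewrite !(octonion_ops R); congr octonion; ring.
Qed.

(** In terms of associators, with flexibility, this reads [(xy, x, z) = (x, z, y) x], an identity of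
    Moufang type. *)
Lemma cayassocMr x y z :
  ((x *o y) *o x) *o z - (x *o y) *o (x *o z) =
  ((x *o z) *o y) *o x - x *o ((z *o y) *o x).
Proof.
by octo x; octo y; octo z; rewrite !(octonion_ops R); congr octonion; ring.
Qed.

Lemma caymul1l x : 1%:O *o x = x.
Proof. by octo x; rewrite !(octonion_ops R); congr octonion; ring. Qed.

Lemma caymul1r x : x *o 1%:O = x.
Proof. by octo x; rewrite !(octonion_ops R); congr octonion; ring. Qed.

Lemma cayrealE k : k%:O = k *: 1%:O :> cay R.
Proof. by rewrite /cayreal scale1r. Qed.

Lemma cayrealD k l : (k + l)%:O = k%:O + l%:O.
Proof. by rewrite /cayreal scalerDl. Qed.

Lemma cayreal_eq0 k : (k%:O == 0) = (k == 0).
Proof.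
apply/eqP/eqP => [/rowP/(_ ord0)|->]; last by rewrite /cayreal scale0r.
by rewrite !mxE /= mulr1.
Qed.

Lemma cay1_neq0 : 1%:O != 0 :> cay R.
Proof. by rewrite cayreal_eq0 oner_eq0. Qed.

Lemma cayconjK x : cayconj (cayconj x) = x.
Proof. by octo x; rewrite !(octonion_ops R); congr octonion; ring. Qed.

Lemma cayconjM x y : cayconj (x *o y) = cayconj y *o cayconj x.
Proof. by octo x; octo y; rewrite !(octonion_ops R); congr octonion; ring. Qed.

Lemma cayconjD x y : cayconj (x + y) = cayconj x + cayconj y.
Proof. by octo x; octo y; rewrite !(octonion_ops R); congr octonion; ring. Qed.

Lemma cayconjN x : cayconj (- x) = - cayconj x.
Proof. by octo x; rewrite !(octonion_ops R). Qed.

Lemma cayconjZ k x : cayconj (k *: x) = k *: cayconj x.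
Proof. by octo x; rewrite !(octonion_ops R); congr octonion; ring. Qed.

Lemma cayconjO k : cayconj k%:O = k%:O.
Proof. by rewrite !(octonion_ops R) oppr0. Qed.

Lemma cayconj0 : cayconj 0 = 0 :> cay R.
Proof. by rewrite -[in LHS](scale0r 1%:O) cayconjZ scale0r. Qed.

Lemma cayconj_eq0 x : (cayconj x == 0) = (x == 0).
Proof.
apply/eqP/eqP => [h|->]; last exact: cayconj0.
by rewrite -[x]cayconjK h cayconj0.
Qed.

Lemma cayaddconj x : x + cayconj x = (2 * x ord0 ord0)%:O.
Proof. by octo x; rewrite !(octonion_ops R); congr octonion; ring. Qed.

Lemma cayconj_re x : cayconj x ord0 ord0 = x ord0 ord0.
Proof. by rewrite mxE eqxx. Qed.

(** The conjugate of [x] lies in the span of [1] and [x], so alternativity suffices. All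
    cancellations of inverses below rest on this law and its mirror image. *)
Lemma cayconjmulK x y : cayconj x *o (x *o y) = caynorm x *: y.
Proof. by octo x; octo y; rewrite !(octonion_ops R); congr octonion; ring. Qed.

Lemma caymulconjK x y : (y *o x) *o cayconj x = caynorm x *: y.
Proof. by octo x; octo y; rewrite !(octonion_ops R); congr octonion; ring. Qed.

Lemma cayconjmul x : cayconj x *o x = (caynorm x)%:O.
Proof.
by have := cayconjmulK x 1%:O; rewrite caymul1r => ->; rewrite -cayrealE.
Qed.

Lemma caynorm_conj x : caynorm (cayconj x) = caynorm x.
Proof. by octo x; rewrite !(octonion_ops R); ring. Qed.

Lemma caynormM x y : caynorm (x *o y) = caynorm x * caynorm y.
Proof. by octo x; octo y; rewrite !(octonion_ops R); ring. Qed.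

Lemma caynormZ k x : caynorm (k *: x) = k ^+ 2 * caynorm x.
Proof. by octo x; rewrite !(octonion_ops R); ring. Qed.

Lemma caynormO k : caynorm k%:O = k ^+ 2.
Proof. by rewrite !(octonion_ops R); ring. Qed.

Lemma caynorm_ge0 x : 0 <= caynorm x.
Proof. by apply: sumr_ge0 => i _; apply: sqr_ge0. Qed.

Lemma caynorm0 : caynorm 0 = 0 :> R.
Proof. by rewrite -(scale0r 1%:O) caynormZ expr0n mul0r. Qed.

Lemma caynorm_eq0 x : (caynorm x == 0) = (x == 0).
Proof.
apply/eqP/eqP => [|->]; last exact: caynorm0.
move=> /eqP; rewrite psumr_eq0; last by move=> i _; apply: sqr_ge0.
move=> /allP h; apply/rowP => i; apply/eqP; rewrite mxE -sqrf_eq0.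
exact: (h i (mem_index_enum i)).
Qed.

Lemma caynorm_gt0 x : (0 < caynorm x) = (x != 0).
Proof. by rewrite lt_def caynorm_ge0 andbT caynorm_eq0. Qed.

Lemma caymod2 x : caymod x ^+ 2 = caynorm x.
Proof. by rewrite sqr_sqrtr // caynorm_ge0. Qed.

Lemma caynorm_sub1 x :
  caynorm (1%:O - x) = 1 - 2 * x ord0 ord0 + caynorm x.
Proof. by octo x; rewrite !(octonion_ops R); ring. Qed.

Lemma cayre_inv x : cayinv x ord0 ord0 = (caynorm x)^-1 * x ord0 ord0.
Proof. by rewrite !mxE eqxx. Qed.

Lemma caynorm_inv x : caynorm (cayinv x) = (caynorm x)^-1.
Proof.
rewrite caynormZ caynorm_conj; have [->|x0] := eqVneq x 0.
  by rewrite caynorm0 invr0 mulr0.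
by rewrite expr2 -mulrA mulVf ?mulr1// caynorm_eq0.
Qed.

Lemma cayinv0 : cayinv 0 = 0 :> cay R.
Proof. by rewrite /cayinv cayconj0 scaler0. Qed.

Lemma cayinvK x : cayinv (cayinv x) = x.
Proof.
have [->|x0] := eqVneq x 0; first by rewrite !cayinv0.
rewrite {1}/cayinv caynorm_inv invrK cayconjZ cayconjK scalerA mulfV ?scale1r//.
by rewrite caynorm_eq0.
Qed.

Lemma cayinv_eq0 x : (cayinv x == 0) = (x == 0).
Proof.
apply/eqP/eqP => [h|->]; last exact: cayinv0.
by rewrite -[x]cayinvK h cayinv0.
Qed.

Lemma cayinvZ k x : cayinv (k *: x) = k^-1 *: cayinv x.
Proof.
rewrite /cayinv caynormZ cayconjZ !scalerA; congr (_ *: _).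
have [->|k0] := eqVneq k 0; first by rewrite invr0 !mul0r mulr0.
by rewrite invfM mulrAC; congr (_ * _); rewrite expr2 invfM -mulrA mulVf ?mulr1.
Qed.

Lemma cayinvN x : cayinv (- x) = - cayinv x.
Proof. by rewrite -scaleN1r cayinvZ invrN1 scaleN1r. Qed.

Lemma cayinv_conj x : cayinv (cayconj x) = cayconj (cayinv x).
Proof. by rewrite /cayinv caynorm_conj cayconjZ. Qed.

Lemma cayinvM x y : cayinv (x *o y) = cayinv y *o cayinv x.
Proof.
rewrite /cayinv caynormM cayconjM caymulZl caymulZr scalerA.
by rewrite invfM mulrC.
Qed.

Lemma cayVKl x y : x != 0 -> cayinv x *o (x *o y) = y.
Proof.
move=> x0; rewrite /cayinv caymulZl cayconjmulK scalerA mulVf ?scale1r//.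
by rewrite caynorm_eq0.
Qed.

Lemma cayKVl x y : x != 0 -> x *o (cayinv x *o y) = y.
Proof. by move=> x0; rewrite -{1}[x]cayinvK cayVKl// cayinv_eq0. Qed.

Lemma cayKVr x y : x != 0 -> (y *o x) *o cayinv x = y.
Proof.
move=> x0; rewrite /cayinv caymulZr caymulconjK scalerA mulVf ?scale1r//.
by rewrite caynorm_eq0.
Qed.

Lemma cayVKr x y : x != 0 -> (y *o cayinv x) *o x = y.
Proof. by move=> x0; rewrite -{2}[x]cayinvK cayKVr// cayinv_eq0. Qed.

Lemma caymulV x : x != 0 -> x *o cayinv x = 1%:O.
Proof. by move=> x0; have := cayKVr 1%:O x0; rewrite caymul1l. Qed.

Lemma caymulVl x : x != 0 -> cayinv x *o x = 1%:O.
Proof. by move=> x0; have := cayVKl 1%:O x0; rewrite caymul1r. Qed.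

Lemma cayinv1 : cayinv 1%:O = 1%:O :> cay R.
Proof. by rewrite -[RHS](caymulV cay1_neq0) caymul1l. Qed.

Lemma caymul_eq0 x y : (x *o y == 0) = (x == 0) || (y == 0).
Proof. by rewrite -!caynorm_eq0 caynormM mulf_eq0. Qed.

Lemma cayimcay x : imcay x -> cayconj x = - x.
Proof.
rewrite /imcay /= /cayim => xE.
by rewrite {1}xE cayconjZ cayconjD cayconjN cayconjK -opprB scalerN -xE.
Qed.
Lemma caycoordD x y j : (x + y) ord0 j = x ord0 j + y ord0 j.
Proof. exact: mxE. Qed.

Lemma caycoordN x j : (- x) ord0 j = - x ord0 j.
Proof. exact: mxE. Qed.

Lemma caycoordZ k x j : (k *: x) ord0 j = k * x ord0 j.
Proof. exact: mxE. Qed.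

Lemma caycoord0 j : (0 : cay R) ord0 j = 0.
Proof. exact: mxE. Qed.

End OctonionIdentities.

(* [cayinv] and [cayreal] unfold to scaled octonions, so that [caymulZl] would
   rewrite inside them: they are hidden before expanding products. *)
Ltac cay_expand :=
  rewrite ?(caymul1l, caymul1r);
  lazymatch goal with
  | |- context [cayinv ?x] =>
      let i := fresh "i" in let E := fresh "E" in
      remember (cayinv x) as i eqn:E; cay_expand; subst i
  | |- context [cayreal ?x] =>
      let i := fresh "i" in let E := fresh "E" in
      remember (cayreal x) as i eqn:E; cay_expand; subst i
  | |- _ => rewrite ?(caymulDl, caymulDr, caymulNl, caymulNr, caymulZl,
      caymulZr, caymul0l, caymul0r)
  end;
  rewrite ?(caymul1l, caymul1r).
(** For goals linear over [R] in octonion atoms: products, inverses and real octonions stay opaque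
    and coordinates are compared. *)
Ltac cay_lin :=
  repeat match goal with
  | |- context [cayinv ?x] => generalize (cayinv x) => ?
  | |- context [cayreal ?k] => generalize (cayreal k) => ?
  end;
  apply/rowP => ?;
  rewrite ?(caycoordD, caycoordN, caycoordZ, caycoord0); by field.
Ltac cay_bilin := cay_expand; cay_lin.

(** * Derivatives *)

Section OctonionCurves.
Variable R : realType.
Implicit Types (x y z u v w : cay R) (k l t : R) (f g : R -> cay R).

Lemma is_derive_mxP m n (f : R -> 'M[R]_(m, n)) t df :
  is_derive t 1 f df <->
  forall i j, is_derive t 1 (fun s => f s i j) (df i j).
Proof.
split=> [[fd fE] i j|h].
  have fij := (derivable_mxP f t 1).1 fd i j.
  by apply: DeriveDef => //; rewrite -fE derive_mx// mxE.
have fd : derivable f t 1 by apply/derivable_mxP => i j; have [] := h i j.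
apply: DeriveDef => //; rewrite derive_mx//; apply/matrixP => i j.
by rewrite mxE; have [] := h i j.
Qed.

Lemma is_derive_cayE f t df i :
  is_derive t 1 f df -> is_derive t 1 (fun s => f s ord0 i) (df ord0 i).
Proof. by move=> /is_derive_mxP. Qed.

Lemma is_derive_mul f g t df dg :
  is_derive t 1 f df -> is_derive t 1 g dg ->
  is_derive t 1 (fun s => f s *o g s) (df *o g t + f t *o dg).
Proof.
move=> hf hg; apply/is_derive_mxP => i k; rewrite (ord1 i).
rewrite (_ : (fun s => _) =
  \sum_(i < 8) \sum_(j < 8) (fun s => cay_coef R i j k * f s ord0 i * g s ord0
      j));
  last first.
  apply/funext => s; rewrite mxE fct_sumE; apply: eq_bigr => a _.
  by rewrite fct_sumE.
apply: is_derive_eq.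
  apply: is_derive_sum => a; apply: is_derive_sum => b.
  apply: is_deriveM; last exact: is_derive_cayE.
  by apply: is_deriveZ; exact: is_derive_cayE.
rewrite !mxE -big_split; apply: eq_bigr => a _; rewrite -big_split.
by apply: eq_bigr => b _ /=; rewrite /GRing.scale /=; ring.
Qed.

Lemma is_derive_scale (k : R -> R) f t (dk : R) df :
  is_derive t 1 k dk -> is_derive t 1 f df ->
  is_derive t 1 (fun s => k s *: f s) (dk *: f t + k t *: df).
Proof.
move=> hk hf; apply/is_derive_mxP => i j; rewrite (ord1 i).
rewrite (_ : (fun s => _) = k * (fun s => f s ord0 j)); last first.
  by apply/funext => s; rewrite mxE.
apply: is_derive_eq; first by apply: is_deriveM; exact: is_derive_cayE.
by rewrite !mxE /GRing.scale /=; ring.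
Qed.

Lemma is_derive_conj f t df :
  is_derive t 1 f df -> is_derive t 1 (fun s => cayconj (f s)) (cayconj df).
Proof.
move=> hf; apply/is_derive_mxP => i j; rewrite (ord1 i) mxE.
case: ifP => j0.
  rewrite (_ : (fun s => _) = (fun s => f s ord0 j)); last first.
    by apply/funext => s; rewrite mxE j0.
  exact: is_derive_cayE.
rewrite (_ : (fun s => _) = - (fun s => f s ord0 j)); last first.
  by apply/funext => s; rewrite mxE j0.
by apply: is_deriveN; exact: is_derive_cayE.
Qed.

(** Differentiates [N(x)^-1] times the conjugate of [x], the norm being the real coordinate of [x]
    times its conjugate. By flexibility the bracketing of the result is immaterial. *)
Lemma is_derive_inv f t df : f t != 0 -> is_derive t 1 f df ->
  is_derive t 1 (fun s => cayinv (f s)) (- (cayinv (f t) *o df *o cayinv (f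
      t))).
Proof.
move=> ft0 hf.
pose n s := caynorm (f s).
have nE : n = (fun s => (f s *o cayconj (f s)) ord0 ord0).
  apply/funext => s; rewrite /n.
  have := caymulconjK (f s) 1%:O; rewrite caymul1l => ->.
  by rewrite !mxE /= !mulr1.
have hn : is_derive t 1 n
    ((df *o cayconj (f t) + f t *o cayconj df) ord0 ord0).
  rewrite nE; apply: is_derive_cayE.
  by apply: is_derive_mul => //; exact: is_derive_conj.
have n0 : n t != 0 by rewrite caynorm_eq0.
apply: is_derive_eq (is_derive_scale (is_deriveV n0 hn) (is_derive_conj hf)) _.
rewrite /cayinv -/(n t) !(caymulZl, caymulZr, scalerA).
(* Both terms are brought over the squared norm; a polynomial identity remains. *)
have -> : (n t)^-1 *: cayconj df = ((n t)^-1 * (n t)^-1) *: (n t *: cayconj df).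
  by rewrite scalerA -mulrA mulVf// mulr1.
rewrite -[X in X *: _ + _]/(_ * _) expr2 invfM mulNr scaleNr addrC.
rewrite -!scalerA -!scalerN -!scalerDr; do 2 congr (_ *: _).
rewrite /n; move: (f t) => x; octo x; octo df; rewrite !(octonion_ops R).
by congr octonion; ring.
Qed.

Lemma is_derive_affine x v t :
  is_derive t (1 : R) (fun s => x + s *: v) v.
Proof.
apply: is_derive_eq (is_deriveD (is_derive_cst x t (1 : R))
  (is_derive_scale (is_derive_id t (1 : R)) (is_derive_cst v t (1 : R)))) _.
by rewrite scaler0 addr0 add0r scale1r.
Qed.

Lemma is_derive_pow m t :
  is_derive t (1 : R) (fun s => s ^+ m) (m%:R * t ^+ m.-1).
Proof.
apply: DeriveDef; first exact: exprn_derivable.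
by rewrite exp_derive /GRing.scale /= mulr1.
Qed.

Lemma is_derive_cst_eq0 f :
  (forall t, is_derive t 1 f 0) -> forall s t, f s = f t.
Proof.
move=> h s t; apply/rowP => j.
apply: (@is_derive_0_is_cst _ (fun s => f s ord0 j)) => r.
by have := is_derive_cayE j (h r); rewrite mxE.
Qed.

End OctonionCurves.

(** * Directional derivatives, chain rule and differentiability of fields *)

Section FieldDerivatives.
Variable R : realType.
Implicit Types t : R.

(** Reduces the directional derivatives in [ad] to derivatives of curves at 0. *)
Lemma is_derive_lineP (V W : normedModType R) (F : V -> W) (p v : V) (d : W) :
  is_derive p v F d <-> is_derive (0 : R) (1 : R) (fun h : R => F (h *: v + p))
      d.
Proof.
have E : 'D_v F p = 'D_1 (fun h : R => F (h *: v + p)) 0.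
  rewrite /derive; set g1 := fun h => h^-1 *: _; set g2 := fun h => h^-1 *: _.
  suff -> : g1 = g2 by [].
  by apply/funext => h; rewrite /g1 /g2 /= addr0 scale0r add0r [_%:A]mulr1.
split=> -[Fd FE]; apply: DeriveDef.
- by rewrite -derivable1P.
- by rewrite -E.
- by rewrite derivable1P.
- by rewrite E.
Qed.

Lemma is_derive_diff (W : normedModType R) (f : R -> W) t df :
  is_derive t (1 : R) f df -> differentiable f t /\ 'd f t 1 = df.
Proof.
move=> [fd fE]; have fdiff : differentiable f t by apply/derivable1_diffP.
by split=> //; rewrite -deriveE.
Qed.

Lemma diff_is_derive (W : normedModType R) (f : R -> W) t :
  differentiable f t -> is_derive t (1 : R) f ('d f t 1).
Proof.
by move=> fd; apply: DeriveDef; [exact: diff_derivable|exact: deriveE].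
Qed.

Lemma is_derive_chain (V W : normedModType R) (F : V -> W) (c : R -> V) t (dc :
    V) :
  differentiable F (c t) -> is_derive t (1 : R) c dc ->
  is_derive t (1 : R) (fun s => F (c s)) ('D_dc F (c t)).
Proof.
move=> Fd /is_derive_diff[cd <-].
rewrite deriveE// -[X in is_derive _ _ X]/(F \o c).
apply: is_derive_eq; first by apply: diff_is_derive; exact: differentiable_comp.
by rewrite diff_comp.
Qed.

Lemma is_derive_pair (V W : normedModType R) (f : R -> V) (g : R -> W) t df dg :
  is_derive t (1 : R) f df -> is_derive t (1 : R) g dg ->
  is_derive t (1 : R) (fun s => (f s, g s)) (df, dg).
Proof.
move=> /is_derive_diff[fd <-] /is_derive_diff[gd <-].
apply: is_derive_eq; first by apply: diff_is_derive; exact: differentiable_pair.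
by rewrite diff_pair.
Qed.

Lemma is_derive_fst (V W : normedModType R) (f : R -> V * W) t df :
  is_derive t (1 : R) f df -> is_derive t (1 : R) (fun s => (f s).1) df.1.
Proof.
move=> [/cvg_ex[l fl] fE].
have lE : l = df by rewrite -fE; apply/esym/cvg_lim.
have gl : h^-1 *: (((fun s => (f s).1) \o shift t) (h *: 1) - (f t).1)
    @[h --> 0^'] --> df.1.
  by rewrite -lE; exact: (cvg_comp _ _ fl (@cvg_fst _ _ _ _ _)).
by apply: DeriveDef; [apply/cvg_ex; exists df.1|exact/cvg_lim].
Qed.

Lemma is_derive_snd (V W : normedModType R) (f : R -> V * W) t df :
  is_derive t (1 : R) f df -> is_derive t (1 : R) (fun s => (f s).2) df.2.
Proof.
move=> [/cvg_ex[l fl] fE].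
have lE : l = df by rewrite -fE; apply/esym/cvg_lim.
have gl : h^-1 *: (((fun s => (f s).2) \o shift t) (h *: 1) - (f t).2)
    @[h --> 0^'] --> df.2.
  by rewrite -lE; exact: (cvg_comp _ _ fl (@cvg_snd _ _ _ _ _)).
by apply: DeriveDef; [apply/cvg_ex; exists df.2|exact/cvg_lim].
Qed.

Lemma is_derive_continuous (W : normedModType R) (f : R -> W) t df :
  is_derive t (1 : R) f df -> {for t, continuous f}.
Proof. by move=> /is_derive_diff[fd _]; exact: differentiable_continuous. Qed.

Lemma is_derive_unique (W : normedModType R) (f : R -> W) t d1 d2 :
  is_derive t (1 : R) f d1 -> is_derive t (1 : R) f d2 -> d1 = d2.
Proof. by move=> [_ <-] [_ <-]. Qed.

Lemma differentiable_fst (V W : normedModType R) (p : V * W) :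
  differentiable (fun q : V * W => q.1) p.
Proof. by apply: (@linear_differentiable _ _ _ fst) => q; exact: cvg_fst. Qed.

Lemma differentiable_snd (V W : normedModType R) (p : V * W) :
  differentiable (fun q : V * W => q.2) p.
Proof. by apply: (@linear_differentiable _ _ _ snd) => q; exact: cvg_snd. Qed.

Lemma differentiable_caymul (V : normedModType R) (f g : V -> cay R) p :
  differentiable f p -> differentiable g p ->
  differentiable (fun q => f q *o g q) p.
Proof.
move=> fd gd.
rewrite (_ : (fun q => _) = \sum_(i < 8) \sum_(j < 8) (fun q =>
    (f q ord0 i * g q ord0 j) *: \row_k cay_coef R i j k)); last first.
  apply/funext => q; apply/rowP => k; rewrite mxE fct_sumE summxE.
  apply: eq_bigr => i _; rewrite fct_sumE summxE; apply: eq_bigr => j _.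
  by rewrite !mxE; ring.
apply: differentiable_sum => i; apply: differentiable_sum => j.
apply: differentiableZl; apply: differentiableM.
  exact: (differentiable_comp fd (differentiable_coord _ _ _)).
exact: (differentiable_comp gd (differentiable_coord _ _ _)).
Qed.

End FieldDerivatives.

(** * The Siegel chart *)

Section SiegelChart.
Variable R : realType.
Implicit Types (x y z u v w c X Y U V : cay R) (p q : plane R).

(* The Cayley transform [X = x2 (1 - x1)^-1], [Y = (1 + x1) (1 - x1)^-1], which
   sends the point [(1, 0)] fixed by [A N] to [PInfty] and is extended to the
   points of the line [x1 = 1] and to the points at infinity. *)
Definition siegel p : plane R :=
  match p with
  | PFin x y =>
      if x != 1%:O then
        PFin (y *o cayinv (1%:O - x)) (2 *: cayinv (1%:O - x) - 1%:O)
      else if y != 0 then PInf (2 *: cayinv y) else PInfty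
  | PInf u => PFin (- u) (- 1%:O)
  | PInfty => PInf 0
  end.

Definition siegel_inv p : plane R :=
  match p with
  | PFin X Y =>
      if Y != - 1%:O then
        PFin (1%:O - 2 *: cayinv (Y + 1%:O)) (2 *: (X *o cayinv (Y + 1%:O)))
      else PInf (- X)
  | PInf u => if u != 0 then PFin 1%:O (2 *: cayinv u) else PInfty
  | PInfty => PFin 1%:O 0
  end.

Lemma two_scale_eq0 x : (2 *: x == 0) = (x == 0).
Proof. by rewrite scaler_eq0 pnatr_eq0. Qed.

Lemma half2 x : 2^-1 *: (2 *: x) = x.
Proof. by rewrite scalerA mulVf ?scale1r// pnatr_eq0. Qed.

Lemma two_half x : 2 *: (2^-1 *: x) = x.
Proof. by rewrite scalerA mulfV ?scale1r// pnatr_eq0. Qed.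

Lemma siegelK : cancel siegel siegel_inv.
Proof.
case=> [x y|u|] /=; last by rewrite eqxx.
- have [->|x1] /= := eqVneq x 1%:O.
    have [->|y0] //= := eqVneq y 0.
    by rewrite two_scale_eq0 cayinv_eq0 y0 cayinvZ cayinvK two_half.
  have a0 : 1%:O - x != 0 by rewrite subr_eq0 eq_sym.
  rewrite -subr_eq0 opprK subrK two_scale_eq0 cayinv_eq0 a0 /=.
  by rewrite cayinvZ cayinvK caymulZr !two_half subKr cayVKr.
- by rewrite eqxx /= opprK.
Qed.

Lemma siegel_invK : cancel siegel_inv siegel.
Proof.
case=> [X Y|u|] /=; last by rewrite !eqxx.
- have [->|Y1] /= := eqVneq Y (- 1%:O); first by rewrite opprK.
  have a0 : Y + 1%:O != 0 by rewrite addr_eq0.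
  rewrite -subr_eq0 addrAC subrr add0r oppr_eq0 two_scale_eq0 cayinv_eq0 a0 /=.
  rewrite subKr cayinvZ cayinvK caymulZr caymulZl half2 two_half.
  by rewrite cayVKr// addrK.
- have [->//|u0] /= := eqVneq u 0.
  by rewrite eqxx /= two_scale_eq0 cayinv_eq0 u0 cayinvZ cayinvK two_half.
Qed.

Lemma siegel_bij : bijective siegel.
Proof. by exists siegel_inv; [exact: siegelK|exact: siegel_invK]. Qed.

(** With [a = 1 - x] the equation reads [2 a^-1 = U (y a^-1) + V + 1]. Cancelling [U] on the left,
    then [a^-1] on the right, gives [y = 2 U^-1 - (U^-1 (1 + V)) a], which is affine in [x];
    alternativity allows both cancellations. *)
Lemma siegel_line2 U V : U != 0 ->
  siegel @^-1` line2 U V =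
  line2 (cayinv U + cayinv U *o V) (cayinv U - cayinv U *o V).
Proof.
move=> U0; apply/funext => p; apply/propext; case: p => [x y|u|] /=.
- have [->|x1] /= := eqVneq x 1%:O.
    have -> : (cayinv U + cayinv U *o V) *o 1%:O + (cayinv U - cayinv U *o V) =
        2 *: cayinv U by cay_bilin.
    have [->|y0] /= := eqVneq y 0.
      split=> // /eqP; rewrite eq_sym two_scale_eq0 cayinv_eq0.
      by rewrite (negPf U0).
    split=> [<-|->]; rewrite cayinvZ cayinvK ?two_half//.
  have a0 : 1%:O - x != 0 by rewrite subr_eq0 eq_sym.
  have -> : (cayinv U + cayinv U *o V) *o x + (cayinv U - cayinv U *o V) =
      2 *: cayinv U - (cayinv U *o (1%:O + V)) *o (1%:O - x) by cay_bilin.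
  move: (1%:O - x) a0 => {x1}a a0.
  split=> [h|->].
    have -> : 1%:O + V = 2 *: cayinv a - U *o (y *o cayinv a).
      have -> : 2 *: cayinv a = U *o (y *o cayinv a) + V + 1%:O.
        by rewrite -h subrK.
      by cay_lin.
    by cay_expand; rewrite cayVKl// !cayVKr//; cay_lin.
  by cay_expand; rewrite !cayKVr// !cayKVl// caymulV//; cay_lin.
- rewrite caymulNr; split=> [h|->].
    have -> : V = U *o u - 1%:O by rewrite h; cay_lin.
    by cay_expand; rewrite cayVKl// addrC subrK.
  by cay_expand; rewrite cayKVl// caymulV//; cay_lin.
- by split=> // /esym/eqP; rewrite (negPf U0).
Qed.

Lemma siegel_line2_0 V : V != - 1%:O ->
  siegel @^-1` line2 0 V = line1 (1%:O - 2 *: cayinv (V + 1%:O)).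
Proof.
move=> V1; have V0 : V + 1%:O != 0 by rewrite addr_eq0.
have c1 : 1%:O != 1%:O - 2 *: cayinv (V + 1%:O).
  by rewrite eq_sym -subr_eq0 addrAC subrr add0r oppr_eq0 two_scale_eq0
      cayinv_eq0.
apply/funext => p; apply/propext; case: p => [x y|u|] /=.
- have [->|x1] /= := eqVneq x 1%:O.
    split=> [|/eqP]; last by rewrite (negPf c1).
    have [->|y0] //= := eqVneq y 0.
    by move=> /eqP; rewrite two_scale_eq0 cayinv_eq0 (negPf y0).
  rewrite caymul0l add0r; split=> [<-|->].
    by rewrite subrK cayinvZ cayinvK two_half subKr.
  by rewrite subKr cayinvZ cayinvK two_half addrK.
- by rewrite caymul0l add0r; split=> // /eqP; rewrite eq_sym (negPf V1).
- by [].
Qed.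

Lemma siegel_line2_0N1 : siegel @^-1` line2 0 (- 1%:O) = @line_infty R.
Proof.
apply/funext => p; apply/propext; case: p => [x y|u|] /=.
- split=> //; have [->|x1] /= := eqVneq x 1%:O.
    have [->|y0] //= := eqVneq y 0.
    by move=> /eqP; rewrite two_scale_eq0 cayinv_eq0 (negPf y0).
  rewrite caymul0l add0r => /eqP.
  rewrite -subr_eq0 opprK subrK two_scale_eq0 cayinv_eq0 subr_eq0 eq_sym.
  by rewrite (negPf x1).
- by rewrite caymul0l add0r.
- by [].
Qed.

(** Vertical lines of the chart come from lines through [(1, 0)], the point sent to [PInfty]. *)
Lemma siegel_line1 c : siegel @^-1` line1 c = line2 (- c) c.
Proof.
apply/funext => p; apply/propext; case: p => [x y|u|] /=.
- have [->|x1] /= := eqVneq x 1%:O.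
    rewrite caymul1r addNr.
    by have [->|y0] //= := eqVneq y 0; split=> // /eqP; rewrite (negPf y0).
  have a0 : 1%:O - x != 0 by rewrite subr_eq0 eq_sym.
  have -> : - c *o x + c = c *o (1%:O - x) by cay_bilin.
  by split=> [<-|->]; rewrite ?cayVKr// cayKVr.
- by split=> [<-|->]; rewrite opprK.
- by [].
Qed.

Lemma siegel_line_infty : siegel @^-1` @line_infty R = line1 1%:O.
Proof.
apply/funext => p; apply/propext; case: p => [x y|u|] //=.
have [->|x1] /= := eqVneq x 1%:O; first by case: eqVneq.
by split=> // /eqP; rewrite (negPf x1).
Qed.

(** Preimages of lines are lines by the formulas above. Conversely each type of line is exhibited as
    the preimage of a line, and taking preimages under a bijection is injective. *)
Lemma is_line_siegel_preimage L : is_line (siegel @^-1` L) <-> is_line L.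
Proof.
have pull L' : is_line L' -> is_line (siegel @^-1` L').
  case=> [[U [V ->]]|[c ->]|->].
  - have [->|U0] := eqVneq U 0; last by rewrite siegel_line2//; apply: Or31; do
        2 eexists.
    have [->|V1] := eqVneq V (- 1%:O); first by rewrite siegel_line2_0N1;
        exact: Or33.
    by rewrite siegel_line2_0//; apply: Or32; eexists.
  - by rewrite siegel_line1; apply: Or31; do 2 eexists.
  - by rewrite siegel_line_infty; apply: Or32; eexists.
split=> [|/pull//].
have inj L1 L2 : siegel @^-1` L1 = siegel @^-1` L2 -> L1 = L2.
  move=> e; apply/funext => p; rewrite -[p]siegel_invK.
  by move/(congr1 (fun L => L (siegel_inv p))): e.
case=> [[u [v e]]|[c e]|e].
- have [uv|uv] := eqVneq (u + v) 0.
    have uE : u = - v by apply/eqP; rewrite -addr_eq0 uv.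
    apply: Or32; exists v; apply: inj.
    by rewrite e siegel_line1 uE.
  (* The coefficients solve [u = U^-1 + U^-1 V] and [v = U^-1 - U^-1 V], whose sum and difference
     are [2 U^-1] and [2 U^-1 V]. *)
  have U0 : 2 *: cayinv (u + v) != 0 by rewrite two_scale_eq0 cayinv_eq0.
  apply: Or31; exists (2 *: cayinv (u + v)), (cayinv (u + v) *o (u - v)).
  apply: inj; rewrite e siegel_line2// cayinvZ cayinvK caymulZl cayKVl//.
  by congr line2; cay_lin.
- have [c1|c1] := eqVneq c 1%:O.
    by apply: Or33; apply: inj; rewrite e siegel_line_infty c1.
  apply: Or31; exists 0, (2 *: cayinv (1%:O - c) - 1%:O).
  apply: inj; rewrite e siegel_line2_0.
    by rewrite subrK cayinvZ cayinvK two_half subKr.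
  by rewrite -subr_eq0 opprK subrK two_scale_eq0 cayinv_eq0 subr_eq0 eq_sym.
- by apply: Or31; exists 0, (- 1%:O); apply: inj; rewrite e siegel_line2_0N1.
Qed.

Definition siegel_polarity p : set (plane R) :=
  match p with
  | PFin X Y => line2 (2 *: cayconj X) (- cayconj Y)
  | PInf u => line1 (2^-1 *: cayconj u)
  | PInfty => @line_infty R
  end.

Lemma siegel_polarityE p :
  siegel @^-1` siegel_polarity (siegel p) = polarity p.
Proof.
case: p => [x y|u|] /=.
- have [->|x1] /= := eqVneq x 1%:O.
    have [->|y0] /= := eqVneq y 0.
      by rewrite siegel_line_infty cay1_neq0 cayinv1 cayconjO.
    by rewrite siegel_line1 cayconjZ half2 caymul1l.
  have a0 : 1%:O - x != 0 by rewrite subr_eq0 eq_sym.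
  have xE : x = 1%:O - (1%:O - x) by rewrite subKr.
  move: (1%:O - x) a0 xE => a a0 xE.
  have [->|y0] /= := eqVneq y 0; last first.
    have yi0 : y *o cayinv a != 0 by rewrite caymul_eq0 negb_or y0 cayinv_eq0.
    rewrite siegel_line2 ?two_scale_eq0 ?cayconj_eq0//.
    rewrite cayinvZ cayinv_conj cayinvM cayinvK.
    (* Conjugating both sides removes the conjugations from the coefficients, leaving products in
       [a], [x = 1 - a] and the inverse of [y]. *)
    congr line2; apply: (can_inj (@cayconjK R));
      rewrite !(cayconjO, cayconjD, cayconjN, cayconjZ, cayconjM, cayconjK).
      by rewrite xE; cay_expand; rewrite cayVKl//; cay_lin.
    by cay_expand; rewrite cayVKl//; cay_lin.
  rewrite caymul0l cayconj0 scaler0.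
  have [x0|x0] /= := eqVneq x 0.
    have a1 : a = 1%:O by apply/eqP; rewrite eq_sym -subr_eq0 -xE x0.
    rewrite -siegel_line2_0N1 a1 cayinv1; congr (_ @^-1` line2 _ _).
    by rewrite cayconjD cayconjN cayconjZ cayconjO; cay_lin.
  have i1 : cayinv a - 1%:O = cayinv a *o x.
    by rewrite xE; cay_expand; rewrite caymulVl.
  have VE : - cayconj (2 *: cayinv a - 1%:O) + 1%:O =
      - (2 *: cayconj (cayinv a *o x)).
    by rewrite -i1 !(cayconjO, cayconjD, cayconjN, cayconjZ 2); cay_lin.
  rewrite siegel_line2_0.
    rewrite VE; congr line1.
    rewrite cayinvN cayinvZ cayinv_conj cayinvM cayinvK.
    have -> : a = 1%:O - x by rewrite xE subKr.
    cay_expand; rewrite caymulVl// cayconjD cayconjN cayconjO.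
    by cay_lin.
  rewrite -subr_eq0 opprK VE oppr_eq0 two_scale_eq0 cayconj_eq0 caymul_eq0.
  by rewrite negb_or cayinv_eq0 a0.
- have one1 : 1%:O + 1%:O = 2 *: 1%:O :> cay R by cay_lin.
  have [->|u0] /= := eqVneq u 0.
    rewrite oppr0 cayconj0 scaler0 cayconjN cayconjO opprK siegel_line2_0.
      by rewrite one1 cayinvZ cayinv1 two_half subrr.
    by rewrite -subr_eq0 opprK one1 two_scale_eq0 cay1_neq0.
  rewrite siegel_line2.
    rewrite !(cayconjO, cayconjN, cayinvZ 2, cayinvN, cayinv_conj, opprK).
    by congr line2; cay_bilin.
  by rewrite two_scale_eq0 cayconj_eq0 oppr_eq0.
- by rewrite cayconj0 scaler0 siegel_line1 oppr0.
Qed.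

End SiegelChart.

(** * Automorphisms in the Siegel chart *)

Section SiegelGroup.
Variable R : realType.
Implicit Types (x y z u v w c X Y U V : cay R) (p q : plane R).
Implicit Types (g h : plane R -> plane R) (L : set (plane R)).

Lemma image_can (T : Type) (f f' : T -> T) (L : set T) :
  cancel f f' -> cancel f' f -> f @` L = f' @^-1` L.
Proof.
move=> fK f'K; apply/seteqP; split=> [_ [p Lp <-]|p Lp].
  by rewrite /preimage /= fK.
by exists (f' p).
Qed.

Lemma is_line_siegel L : is_line (@siegel R @` L) <-> is_line L.
Proof.
rewrite -is_line_siegel_preimage.
rewrite (image_can _ (@siegelK R) (@siegel_invK R)).
have -> : @siegel R @^-1` (@siegel_inv R @^-1` L) = L; last by [].
by apply/funext => p; rewrite /preimage /= siegelK.
Qed.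

Lemma is_line_siegel_inv L : is_line (@siegel_inv R @` L) <-> is_line L.
Proof.
by rewrite (image_can _ (@siegel_invK R) (@siegelK R)) is_line_siegel_preimage.
Qed.

Lemma siegel_inv_polarity p :
  @siegel_inv R @` siegel_polarity p = polarity (siegel_inv p).
Proof.
rewrite (image_can _ (@siegel_invK R) (@siegelK R)).
by rewrite -siegel_polarityE siegel_invK.
Qed.

Lemma siegel_polarity_siegel p :
  @siegel R @` polarity p = siegel_polarity (siegel p).
Proof.
rewrite -[in LHS](siegelK p) -siegel_inv_polarity image_comp.
rewrite (_ : _ \o _ = id) ?image_id//.
by apply/funext => q /=; rewrite siegel_invK.
Qed.

Definition siegelG : set (plane R -> plane R) :=
  [set g | collineation g /\
           forall p, g @` siegel_polarity p = siegel_polarity (g p)].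

Lemma image_comp3 (f g h : plane R -> plane R) L :
  (f \o g \o h) @` L = f @` (g @` (h @` L)).
Proof. by rewrite !image_comp. Qed.

Lemma autG_siegel g : autG g -> siegelG (@siegel R \o g \o @siegel_inv R).
Proof.
case=> -[gb gl] gp; split; first split.
- apply: bij_comp; last by exists (@siegel R); [exact: siegel_invK|exact:
      siegelK].
  by apply: bij_comp => //; exact: siegel_bij.
- by move=> L; rewrite !image_comp3 is_line_siegel gl is_line_siegel_inv.
- by move=> p; rewrite !image_comp3 siegel_inv_polarity gp
      siegel_polarity_siegel.
Qed.

Lemma siegelG_aut g : siegelG g -> autG (@siegel_inv R \o g \o @siegel R).
Proof.
case=> -[gb gl] gp; split; first split.
- apply: bij_comp; last exact: siegel_bij.
  apply: bij_comp => //.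
  by exists (@siegel R); [exact: siegel_invK|exact: siegelK].
- by move=> L; rewrite !image_comp3 is_line_siegel_inv gl is_line_siegel.
- move=> p; rewrite !image_comp3 siegel_polarity_siegel gp.
  by rewrite siegel_inv_polarity.
Qed.

Definition siegel_domain p : Prop :=
  match p with PFin X Y => caynorm X < Y ord0 ord0 | _ => False end.

(** With [a = 1 - x], the chart gives [Re Y - |X|^2 = (1 - |x|^2 - |y|^2) / |a|^2]. *)
Lemma siegel_hplane x y : hplane (x, y) <-> siegel_domain (siegel (PFin x y)).
Proof.
rewrite /hplane /= !caymod2.
have [->|x1] /= := eqVneq x 1%:O.
  have -> : caynorm (1%:O : cay R) = 1 by rewrite caynormO expr1n.
  case: eqVneq => _ /=; split=> //; rewrite -subr_gt0;
    by have := caynorm_ge0 y => h1 h2; lra.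
have a0 : 1%:O - x != 0 by rewrite subr_eq0 eq_sym.
have n0 : 0 < caynorm (1%:O - x) by rewrite caynorm_gt0.
rewrite caynormM caynorm_inv caycoordD caycoordZ caycoordN cayre_inv.
have -> : (1%:O : cay R) ord0 ord0 = 1 by rewrite !mxE /= mulr1.
have xE : caynorm x = caynorm (1%:O - x) + 2 * x ord0 ord0 - 1.
  by rewrite caynorm_sub1; ring.
have -> : (1%:O - x) ord0 ord0 = 1 - x ord0 ord0.
  by rewrite !mxE /= mulr1.
rewrite {}xE; move: (caynorm _) n0 => n n0.
rewrite ltr_pdivrMr//.
have -> : (2 * (n^-1 * (1 - x ord0 ord0)) - 1) * n = 2 * (1 - x ord0 ord0) - n.
  by field; rewrite gt_eqF.
by split=> h; lra.
Qed.

(** Completes the square: along the line [Y = u X + v], the function [Re Y - |X|^2] equals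
    [Re v + |u|^2 / 4 - |X - conj u / 2|^2]. *)
Lemma caynorm_subhalf X u :
  caynorm (X - 2^-1 *: cayconj u) =
  caynorm X - (u *o X) ord0 ord0 + caynorm u / 4.
Proof. by octo X; octo u; rewrite !(octonion_ops R); field. Qed.

Definition absolute p : Prop := siegel_polarity p p.

Lemma absolute_fin X Y : absolute (PFin X Y) <-> Y ord0 ord0 = caynorm X.
Proof.
rewrite /absolute /= caymulZl cayconjmul.
split=> [|YE].
  move/(congr1 (fun x : cay R => x ord0 ord0)).
  by rewrite caycoordD caycoordN cayconj_re caycoordZ !mxE /= => h; lra.
apply/eqP; rewrite -subr_eq opprK cayaddconj YE; apply/eqP.
by rewrite /cayreal scalerA.
Qed.

(** Describes the domain by incidence with the absolute quadric alone, which makes its invariance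
    under [siegelG] immediate. *)
Lemma siegel_domainP p : siegel_domain p <->
  ~ absolute p /\
  forall L, is_line L -> L p -> exists2 q, L q & absolute q.
Proof.
split=> [|[]].
- case: p => [X Y|u|] //= pD; split.
    by move=> /absolute_fin h; move: pD; rewrite h ltxx.
  move=> L [[u [v ->]]|[c ->]|->] //=; last by exists PInfty.
  (* By completion of the square, the absolute points of this line are those with
     [|X - conj u / 2|^2 = d]; [d] is nonnegative because the line contains a point of the
     domain. *)
  move=> YE; pose d := v ord0 ord0 + caynorm u / 4.
  have d0 : 0 <= d.
    have := caynorm_ge0 (X - 2^-1 *: cayconj u).
    by move: pD; rewrite YE caycoordD caynorm_subhalf /d => h1 h2; lra.
  pose X' := 2^-1 *: cayconj u + (Num.sqrt d)%:O.
  exists (PFin X' (u *o X' + v)) => //; apply/absolute_fin.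
  have := caynorm_subhalf X' u.
  rewrite {1}/X' addrAC subrr add0r caynormO sqr_sqrtr// caycoordD /d => h.
  by lra.
- case: p => [X Y|u|] /=; last by move=> /(_ I).
    (* On the line of slope [2 conj X] through the point, [Re Y' - |X'|^2 = Re Y - |X|^2 - |X' -
       X|^2], so an absolute point on it forces [|X|^2 <= Re Y]. *)
    move=> nA /(_ (line2 (2 *: cayconj X) (Y - (2 *: cayconj X) *o X))) [].
    - by apply: Or31; do 2 eexists.
    - by rewrite /= addrC subrK.
    case=> [X' Y' /= ->|u _|] //= /absolute_fin.
    rewrite !(caycoordD, caycoordN) => h.
    have := caynorm_ge0 (X' - X).
    have := caynorm_subhalf X' (2 *: cayconj X).
    rewrite cayconjZ cayconjK half2 => ->; rewrite caynormZ caynorm_conj.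
    have e : ((2 *: cayconj X) *o X) ord0 ord0 = 2 * caynorm X.
      by rewrite caymulZl cayconjmul !mxE /= mulr1.
    rewrite {}e in h.
    move=> h2; rewrite lt_neqAle; apply/andP; split.
      by apply/eqP => h3; apply: nA; apply/absolute_fin.
    by move: h h2; lra.
  (* With this constant term [Re v + |u|^2 / 4] is negative, so the line through [PInf u] misses the
     quadric. *)
  move=> _ /(_ (line2 u (- (caynorm u + 1)%:O))) [].
  - by apply: Or31; do 2 eexists.
  - by [].
  case=> [X' Y' /= ->|u' _|] //= /absolute_fin.
  rewrite caycoordD caycoordN.
  have -> : (caynorm u + 1)%:O ord0 ord0 = caynorm u + 1.
    by rewrite !mxE /= mulr1.
  have := caynorm_ge0 (X' - 2^-1 *: cayconj u).
  rewrite caynorm_subhalf; have := caynorm_ge0 u => h1 h2 h3; lra.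
Qed.

Lemma absolute_siegelG g p : siegelG g -> absolute (g p) <-> absolute p.
Proof.
case=> -[/bij_inj gi _] gp; rewrite /absolute -gp; split=> [[q qp /gi qE]|h].
  by rewrite -{2}qE.
by exists p.
Qed.

Lemma siegel_domainG g p : siegelG g -> siegel_domain p -> siegel_domain (g p).
Proof.
move=> gG; have [[[g' gK g'K] gl] _] := gG.
move=> /siegel_domainP[nA pL]; apply/siegel_domainP; split.
  by rewrite absolute_siegelG.
move=> L lL Lgp.
have LE : g @` (g @^-1` L) = L.
  rewrite (image_can _ gK g'K); apply/funext => q.
  by rewrite /preimage /= g'K.
have [||q Lq qA] := pL (g @^-1` L).
- by apply/gl; rewrite LE.
- by [].
by exists (g q) => //; apply/absolute_siegelG.
Qed.

Definition heis z y p : plane R :=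
  match p with
  | PFin X Y =>
      PFin (X + z) (Y + 2 *: (cayconj z *o X) + (caynorm z)%:O + 2 *: y)
  | PInf u => PInf (u + 2 *: cayconj z)
  | PInfty => PInfty
  end.

(** Composing produces the cross term [2 k l |z|^2] that completes [k^2 + l^2] to [(k + l)^2]. *)
Lemma heisD z y k l p :
  heis (k *: z) (k *: y) (heis (l *: z) (l *: y) p) =
  heis ((k + l) *: z) ((k + l) *: y) p.
Proof.
case: p => [X Y|u|] //=; last by rewrite cayconjZ !cayconjZ; congr PInf;
    cay_lin.
rewrite !(cayconjZ k, cayconjZ l, cayconjZ (k + l)) !caynormZ.
congr PFin; first by cay_lin.
rewrite !(cayrealE (_ * _)).
rewrite caymulDr !(caymulZl k, caymulZl l, caymulZl (k + l), caymulZr l).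
by rewrite cayconjmul (cayrealE (caynorm _)); cay_lin.
Qed.

Lemma heis0 p : heis 0 0 p = p.
Proof.
case: p => [X Y|u|] //=; rewrite cayconj0 ?caymul0l !scaler0 !addr0//.
by rewrite caynorm0 (cayrealE 0) scale0r addr0.
Qed.

Lemma heisK z y : cancel (heis z y) (heis (- z) (- y)).
Proof.
move=> p; have := heisD z y (-1) 1 p.
by rewrite !scaleN1r !scale1r addNr !scale0r heis0.
Qed.

Lemma heisNK z y : cancel (heis (- z) (- y)) (heis z y).
Proof. by move=> p; have := heisK (- z) (- y) p; rewrite !opprK. Qed.

Lemma heis_line2 z y u v : heis z y @^-1` line2 u v =
  line2 (u - 2 *: cayconj z) (v + u *o z - (caynorm z)%:O - 2 *: y).
Proof.
apply/funext => p; apply/propext; case: p => [X Y|w|] //=.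
  split=> [h|->]; last by cay_bilin.
  have -> : Y = (Y + 2 *: (cayconj z *o X) + (caynorm z)%:O + 2 *: y)
    - (2 *: (cayconj z *o X) + (caynorm z)%:O + 2 *: y) by cay_lin.
  by rewrite h; cay_bilin.
by split=> [<-|->]; cay_lin.
Qed.

Lemma heis_line1 z y c : heis z y @^-1` line1 c = line1 (c - z).
Proof.
apply/funext => p; apply/propext; case: p => [X Y|w|] //=.
by split=> [<-|->]; cay_lin.
Qed.

Lemma heis_line_infty z y : heis z y @^-1` @line_infty R = @line_infty R.
Proof. by apply/funext => p; apply/propext; case: p. Qed.

(** For the polarity, the constant term [|z|^2 + 2 y] of the translation must become [|z|^2 - 2 y]
    under conjugation; this is where [y] has to be imaginary. *)
Lemma siegelG_heis z y : cayconj y = - y -> siegelG (heis z y).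
Proof.
move=> yE.
have pull z' y' L : is_line L -> is_line (heis z' y' @^-1` L).
  case=> [[u [v ->]]|[c ->]|->].
  - by rewrite heis_line2; apply: Or31; do 2 eexists.
  - by rewrite heis_line1; apply: Or32; eexists.
  - by rewrite heis_line_infty; apply: Or33.
split; first split.
- by exists (heis (- z) (- y)); [exact: heisK|exact: heisNK].
- move=> L; rewrite (image_can _ (@heisK z y) (@heisNK z y)); split; last
      exact: pull.
  move=> /(pull z y).
  have -> // : heis z y @^-1` (heis (- z) (- y) @^-1` L) = L.
  by apply/funext => p; rewrite /preimage /= heisK.
move=> p; rewrite (image_can _ (@heisK z y) (@heisNK z y)).
suff h q : heis z y @^-1` siegel_polarity (heis z y q) = siegel_polarity q.
  rewrite -{1}h; apply/funext => q.
  by rewrite /preimage /= heisNK.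
case: q => [X Y|u|] /=; last by rewrite heis_line_infty.
  rewrite heis_line2 !(cayconjD, cayconjO, cayconjZ 2, cayconjM, cayconjK) yE.
  congr line2; first by cay_lin.
  rewrite (caymulZl 2) caymulDl cayconjmul (cayrealE (caynorm _)).
  by cay_lin.
by rewrite heis_line1 cayconjD cayconjZ cayconjK; congr line1; cay_lin.
Qed.

End SiegelGroup.

(** * The unipotent flows *)

Section RootFields.
Variable R : realType.
Implicit Types (x y z u v w c X Y U V : cay R) (k l s t : R).

(* The generators of [heis (s *: z) 0] and [heis 0 (s *: y)] in the coordinates
   of the ball; the Moufang identities make them polynomial. *)
Definition fieldZ z (p : cay R * cay R) : cay R * cay R :=
  (((1%:O - p.1) *o cayconj z) *o p.2,
   z *o (1%:O - p.1) - (p.2 *o cayconj z) *o p.2).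

Definition fieldY y (p : cay R * cay R) : cay R * cay R :=
  (((1%:O - p.1) *o y) *o (1%:O - p.1), - ((p.2 *o y) *o (1%:O - p.1))).

Definition flow y z s : plane R -> plane R :=
  @siegel_inv R \o heis (s *: z) (s *: y) \o @siegel R.

Lemma one_param_flow y z : cayconj y = - y -> one_param_subgroup (flow y z).
Proof.
move=> yE; split=> [s|s t].
  by apply: siegelG_aut; apply: siegelG_heis; rewrite cayconjZ yE scalerN.
apply/funext => p; rewrite /flow /= siegel_invK.
by rewrite heisD.
Qed.

Lemma siegel_domain_neq0 X Y : siegel_domain (PFin X Y) -> Y + 1%:O != 0.
Proof.
move=> /= h; apply/eqP => /(congr1 (fun x : cay R => x ord0 ord0)).
rewrite !mxE /= mulr1; have := caynorm_ge0 X => h1 h2; lra.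
Qed.

Lemma siegel_inv_fin X Y : siegel_domain (PFin X Y) ->
  siegel_inv (PFin X Y) =
  PFin (1%:O - 2 *: cayinv (Y + 1%:O)) (2 *: (X *o cayinv (Y + 1%:O))).
Proof.
by move=> /siegel_domain_neq0; rewrite /= addr_eq0 => ->.
Qed.

Lemma is_derive_quadratic x v w :
  is_derive (0 : R) (1 : R) (fun s => x + s *: v + s ^+ 2 *: w) v.
Proof.
apply: is_derive_eq (is_deriveD (is_derive_affine x v 0)
  (is_derive_scale (is_derive_pow 2 0) (is_derive_cst w 0 (1 : R)))) _.
by rewrite !scaler0 mulr0 scale0r !addr0.
Qed.

Lemma heis_flow z y X Y s : heis (s *: z) (s *: y) (PFin X Y) =
  PFin (X + s *: z) (Y + s *: (2 *: (cayconj z *o X + y)) +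
                     s ^+ 2 *: (caynorm z)%:O).
Proof.
rewrite /= cayconjZ caynormZ (cayrealE (_ * _)) (cayrealE (caynorm _)).
by rewrite (caymulZl s); congr PFin; cay_lin.
Qed.

(** The ball coordinates of an orbit are [1 - 2 j] and [2 X j], with [j] the inverse of [Y + 1];
    they are differentiated at 0, and Moufang identities then remove the inverse of [1 - x1]. *)
Lemma generator_flow y z : cayconj y = - y ->
  generator (flow y z) (fun p => fieldZ z p + fieldY y p).
Proof.
move=> yE [x1 x2] hp /=.
have hS := (siegel_hplane _ _).1 hp.
have x11 : x1 != 1%:O by apply/eqP => x1E; move: hS; rewrite x1E /= eqxx;
  case: eqVneq.
have a0 : 1%:O - x1 != 0 by rewrite subr_eq0 eq_sym.
move: hS; rewrite /= x11; set q := PFin _ _ => hS.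
(* The orbit stays in the domain, so the finite branch of [siegel_inv] applies at every time. *)
have hS' s : siegel_domain (heis (s *: z) (s *: y) q).
  apply: siegel_domainG => //.
  by apply: siegelG_heis; rewrite cayconjZ yE scalerN.
have fE : (fun s => coords (flow y z s (PFin x1 x2))) = (fun s =>
  let j := cayinv (2 *: cayinv (1%:O - x1) + s *: (2 *: (cayconj z *o (x2 *o
      cayinv (1%:O - x1)) + y)) +
           s ^+ 2 *: (caynorm z)%:O) in
  (1%:O - 2 *: j, 2 *: ((x2 *o cayinv (1%:O - x1) + s *: z) *o j))).
  apply/funext => s; rewrite /flow /= x11; move: (hS' s); rewrite /q heis_flow.
  move=> /siegel_inv_fin ->; rewrite /=.
  by congr (1%:O - 2 *: cayinv _, 2 *: (_ *o cayinv _)); cay_lin.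
rewrite fE {fE hS hS' q}/=.
rewrite /fieldZ /fieldY /=.
move: (1%:O - x1) a0 => a a0.
have [i iE] : exists i, i = cayinv a by eexists.
rewrite -!iE; have i0 : 2 *: i != 0 by rewrite two_scale_eq0 iE cayinv_eq0.
have [w wE] : exists w, w = cayconj z *o (x2 *o i) + y by eexists.
rewrite -!wE.
have hj := is_derive_inv _ (is_derive_quadratic (2 *: i) (2 *: w) (caynorm
    z)%:O).
have hX : is_derive (0 : R) (1 : R) (fun s => x2 *o i + s *: z) z.
  exact: is_derive_affine.
have i2 : cayinv (2 *: i) = 2^-1 *: a by rewrite cayinvZ iE cayinvK.
have {}hj := hj _.
move: hj; rewrite !scale0r expr0n !scale0r !addr0 i2 => /(_ i0) hj.
have hXj := is_derive_mul hX hj.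
apply: is_derive_eq (is_derive_pair (is_deriveB (is_derive_cst 1%:O 0 (1 : R))
  (is_deriveZ 2 hj)) (is_deriveZ 2 hXj)) _.
rewrite !scale0r expr0n !scale0r !addr0 i2.
congr pair; rewrite /= wE.
  have <- : (a *o (cayconj z *o (x2 *o i))) *o a = (a *o cayconj z) *o x2.
    by rewrite -caymoufang iE cayVKr.
  by cay_bilin.
(* The Moufang identity is used twice: inside, with outer factor [a], and then with outer factor
   [x2]. *)
have E1 : (x2 *o i) *o ((a *o (cayconj z *o (x2 *o i))) *o a) = (x2 *o cayconj
    z) *o x2.
  by rewrite -caymoufang iE cayVKr// caymoufang cayVKl.
have E2 : (x2 *o i) *o ((a *o y) *o a) = (x2 *o y) *o a.
  by rewrite -caymoufangr iE cayVKr.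
rewrite -E1 -E2.
by cay_bilin.
Qed.

End RootFields.

(** * The flows lie in [N]; their closed form *)

Section Existence.
Variable R : realType.
Implicit Types (x y z u v w c X Y U V : cay R) (k l s t : R).

Lemma is_derive_expRN0 : is_derive (0 : R) (1 : R) (expR \o -%R) (-1).
Proof.
apply: is_derive_eq (is_derive1_comp (is_derive_expR (- 0)) _) _.
by rewrite oppr0 expR0 mul1r.
Qed.

Lemma is_derive_cosh0 : is_derive (0 : R) (1 : R) (@cosh R) 0.
Proof.
have -> : @cosh R = 2^-1 \*: (expR + (expR \o -%R)).
  by apply/funext => t; rewrite /cosh mulrC.
apply: is_derive_eq (is_deriveZ 2^-1
  (is_deriveD (is_derive_expR 0) is_derive_expRN0)) _.
by rewrite expR0 subrr scaler0.
Qed.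

Lemma is_derive_sinh0 : is_derive (0 : R) (1 : R) (@sinh R) 1.
Proof.
have -> : @sinh R = 2^-1 \*: (expR - (expR \o -%R)).
  by apply/funext => t; rewrite /sinh mulrC.
apply: is_derive_eq (is_deriveZ 2^-1
  (is_deriveB (is_derive_expR 0) is_derive_expRN0)) _.
by rewrite expR0 /GRing.scale /=; field.
Qed.

Lemma cosh0 : cosh 0 = 1 :> R.
Proof. by rewrite /cosh oppr0 expR0; field. Qed.

Lemma sinh0 : sinh 0 = 0 :> R.
Proof. by rewrite /sinh oppr0 expR0 subrr mul0r. Qed.

Lemma fieldXE : @fieldX R =
  fun p => (1%:O - p.1 *o p.1, - (p.2 *o p.1)).
Proof.
apply/funext => -[x1 x2]; rewrite /fieldX derive1E /a_act /=.
have hlin (f g : R -> R) v w df dg :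
    is_derive (0 : R) (1 : R) f df -> is_derive (0 : R) (1 : R) g dg ->
    is_derive (0 : R) (1 : R) (fun t => f t *: v + g t *: w) (df *: v + dg *:
        w).
  move=> hf hg; apply: is_derive_eq (is_deriveD
    (is_derive_scale hf (is_derive_cst v 0 (1 : R)))
    (is_derive_scale hg (is_derive_cst w 0 (1 : R)))) _.
  by rewrite !scaler0 !addr0.
have hd := hlin _ _ x1 1%:O _ _ is_derive_sinh0 is_derive_cosh0.
have hn := hlin _ _ x1 1%:O _ _ is_derive_cosh0 is_derive_sinh0.
have d0 : sinh 0 *: x1 + cosh 0 *: 1%:O != 0.
  by rewrite sinh0 cosh0 scale0r add0r scale1r cay1_neq0.
have hi := is_derive_inv d0 hd.
have [_] := is_derive_pair (is_derive_mul hn hi)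
  (is_derive_mul (is_derive_cst x2 0 (1 : R)) hi).
have -> : (fun s => ((cosh s *: x1 + sinh s *: 1%:O) *o
    cayinv (sinh s *: x1 + cosh s *: 1%:O),
    cst x2 s *o cayinv (sinh s *: x1 + cosh s *: 1%:O))) =
  (fun s => ((cosh s *: x1 + (sinh s)%:O) *o
    cayinv (sinh s *: x1 + (cosh s)%:O),
    x2 *o cayinv (sinh s *: x1 + (cosh s)%:O))).
  by apply/funext => s; rewrite -!cayrealE.
move=> ->; rewrite sinh0 cosh0 !scale0r !scale1r !add0r !addr0 cayinv1.
by congr pair; rewrite /=; cay_bilin.
Qed.

Lemma is_derive_lineE x v : is_derive (0 : R) (1 : R) (fun h => h *: v + x) v.
Proof.
have := is_derive_affine x v 0.
by under eq_fun do rewrite addrC.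
Qed.

Lemma derive_fieldX p q : is_derive p q (@fieldX R)
  (- (q.1 *o p.1 + p.1 *o q.1), - (q.2 *o p.1 + p.2 *o q.1)).
Proof.
apply/is_derive_lineP; rewrite fieldXE /=.
have h1 := is_derive_lineE p.1 q.1.
have h2 := is_derive_lineE p.2 q.2.
apply: is_derive_eq (is_derive_pair
  (is_deriveB (is_derive_cst 1%:O 0 (1 : R)) (is_derive_mul h1 h1))
  (is_deriveN (is_derive_mul h2 h1))) _.
by rewrite !scale0r !add0r.
Qed.

Lemma derive_fieldZ z p q : is_derive p q (fieldZ z)
  ((- q.1 *o cayconj z) *o p.2 + ((1%:O - p.1) *o cayconj z) *o q.2,
   - (z *o q.1) - ((q.2 *o cayconj z) *o p.2 + (p.2 *o cayconj z) *o q.2)).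
Proof.
apply/is_derive_lineP; rewrite /fieldZ /=.
have h1 := is_derive_lineE p.1 q.1.
have h2 := is_derive_lineE p.2 q.2.
have ha := is_deriveB (is_derive_cst 1%:O 0 (1 : R)) h1.
have hz w := is_derive_cst w 0 (1 : R).
apply: is_derive_eq (is_derive_pair
  (is_derive_mul (is_derive_mul ha (hz (cayconj z))) h2)
  (is_deriveB (is_derive_mul (hz z) ha)
     (is_derive_mul (is_derive_mul h2 (hz (cayconj z))) h2))) _.
rewrite /= !scale0r !add0r; congr pair; cay_bilin.
Qed.

Lemma derive_fieldY y p q : is_derive p q (fieldY y)
  (- ((q.1 *o y) *o (1%:O - p.1)) - ((1%:O - p.1) *o y) *o q.1,
   (p.2 *o y) *o q.1 - (q.2 *o y) *o (1%:O - p.1)).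
Proof.
apply/is_derive_lineP; rewrite /fieldY /=.
have h1 := is_derive_lineE p.1 q.1.
have h2 := is_derive_lineE p.2 q.2.
have ha := is_deriveB (is_derive_cst 1%:O 0 (1 : R)) h1.
have hy := is_derive_cst y 0 (1 : R).
apply: is_derive_eq (is_derive_pair
  (is_derive_mul (is_derive_mul ha hy) ha)
  (is_deriveN (is_derive_mul (is_derive_mul h2 hy) ha))) _.
rewrite /= !scale0r !add0r; congr pair; cay_bilin.
Qed.

(** In terms of [a = 1 - x1], the first component reduces to the cyclic symmetry of an associator
    and the second to [cayassocMr]. *)
Lemma ad_fieldZ z p : ad (@fieldX R) (fieldZ z) p = 1 *: fieldZ z p.
Proof.
rewrite /ad; have [_ ->] := derive_fieldX p (fieldZ z p).
have [_ ->] := derive_fieldZ z p (fieldX p).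
rewrite fieldXE scale1r; case: p => x1 x2; rewrite /fieldZ /=.
have -> : x1 = 1%:O - (1%:O - x1) by rewrite subKr.
move: (1%:O - x1) (cayconj z) => a b; rewrite !subKr.
congr pair; rewrite /=.
  have := cayassoc_cyclic a (a *o b) x2; rewrite cayaltl.
  by move=> /eqP; rewrite subr_eq => /eqP h; cay_expand; rewrite h; cay_lin.
have := cayassocMr x2 b a => /eqP; rewrite subr_eq => /eqP h.
by cay_expand; rewrite -cayaltr h; cay_lin.
Qed.

Lemma ad_fieldY y p : ad (@fieldX R) (fieldY y) p = 2 *: fieldY y p.
Proof.
rewrite /ad; have [_ ->] := derive_fieldX p (fieldY y p).
have [_ ->] := derive_fieldY y p (fieldX p).
rewrite fieldXE; case: p => x1 x2; rewrite /fieldY /=.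
have -> : x1 = 1%:O - (1%:O - x1) by rewrite subKr.
move: (1%:O - x1) => a; rewrite !subKr.
congr pair; rewrite /=.
  by cay_expand; rewrite cayaltr -[a *o ((a *o y) *o a)]cayflex cayaltl;
      cay_lin.
by cay_expand; rewrite -caymoufangr cayaltr; cay_lin.
Qed.

Lemma differentiable_fieldZ z p : differentiable (fieldZ z) p.
Proof.
have d1 : differentiable (fun q : cay R * cay R => 1%:O - q.1) p.
  by apply: differentiableB => //; exact: differentiable_fst.
have d2 : differentiable (fun q : cay R * cay R => q.2) p.
  exact: differentiable_snd.
apply: differentiable_pair.
  apply: differentiable_caymul => //; exact: differentiable_caymul.
apply: differentiableB; first exact: differentiable_caymul.
by apply: differentiable_caymul => //; exact: differentiable_caymul.
Qed.

Lemma differentiable_fieldY y p : differentiable (fieldY y) p.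
Proof.
have d1 : differentiable (fun q : cay R * cay R => 1%:O - q.1) p.
  by apply: differentiableB => //; exact: differentiable_fst.
have d2 : differentiable (fun q : cay R * cay R => q.2) p.
  exact: differentiable_snd.
apply: differentiable_pair.
  apply: differentiable_caymul => //; exact: differentiable_caymul.
apply: differentiableN.
by apply: differentiable_caymul => //; exact: differentiable_caymul.
Qed.

Lemma fieldZ0 (p : cay R * cay R) : fieldZ 0 p = 0.
Proof.
by rewrite /fieldZ cayconj0 !(caymul0l, caymul0r) oppr0 addr0.
Qed.

Lemma fieldY0 (p : cay R * cay R) : fieldY 0 p = 0.
Proof. by rewrite /fieldY !(caymul0l, caymul0r) oppr0. Qed.

Lemma groupN_flow y z : cayconj y = - y -> groupN (flow y z 1).
Proof.
move=> yE; exists (fieldZ z), (fieldY y); split.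
- split; last by move=> p _; exact: ad_fieldZ.
  split; last by move=> p _; exact: differentiable_fieldZ.
  have z0 : cayconj 0 = - 0 :> cay R by rewrite cayconj0 oppr0.
  exists (flow 0 z); first exact: one_param_flow.
  have -> : fieldZ z = fun p => fieldZ z p + fieldY 0 p.
    by apply/funext => p; rewrite fieldY0 addr0.
  exact: generator_flow.
- split; last by move=> p _; exact: ad_fieldY.
  split; last by move=> p _; exact: differentiable_fieldY.
  exists (flow y 0); first exact: one_param_flow.
  have -> : fieldY y = fun p => fieldZ 0 p + fieldY y p.
    by apply/funext => p; rewrite fieldZ0 add0r.
  exact: generator_flow.
- by exists (flow y z); split; [exact: one_param_flow|exact: generator_flow|].
Qed.

Lemma hplane_neq1 x1 x2 : hplane (x1, x2) -> 1%:O - x1 != 0.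
Proof.
move=> /siegel_hplane; apply: contraPneq => /eqP; rewrite subr_eq0 => /eqP <-.
by rewrite /= eqxx /=; case: eqVneq => _ /=; case.
Qed.

Lemma siegel_fin x1 x2 : 1%:O - x1 != 0 -> siegel (PFin x1 x2) =
  PFin (x2 *o cayinv (1%:O - x1)) (2 *: cayinv (1%:O - x1) - 1%:O).
Proof. by rewrite subr_eq0 eq_sym /= => ->. Qed.

(** [E] is half of [Y + 1] at the translated point, that is, the inverse of [1 - x1']. It is nonzero
    because the translated point is still in the domain. *)
Lemma flowE y z x1 x2 i E :
  cayconj y = - y -> hplane (x1, x2) -> i = cayinv (1%:O - x1) ->
  E = i + cayconj z *o (x2 *o i) + ((caynorm z / 2)%:O + y) ->
  E != 0 /\
  flow y z 1 (PFin x1 x2) = PFin (1%:O - cayinv E) ((x2 *o i + z) *o cayinv E).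
Proof.
move=> yE hp iE EE; have a0 := hplane_neq1 hp.
have hS : siegel_domain (heis (1 *: z) (1 *: y) (siegel (PFin x1 x2))).
  apply: siegel_domainG; last exact/siegel_hplane.
  by apply: siegelG_heis; rewrite scale1r.
rewrite -[flow _ _ _ _]/(siegel_inv (heis (1 *: z) (1 *: y) (siegel (PFin x1
    x2)))).
move: hS; rewrite (siegel_fin _ a0) -iE heis_flow => hS.
have nE : (caynorm z / 2)%:O = 2^-1 *: (caynorm z)%:O :> cay R.
  by rewrite /cayreal scalerA mulrC.
have E2 : 2 *: i - 1%:O + 1 *: (2 *: (cayconj z *o (x2 *o i) + y)) +
    1 ^+ 2 *: (caynorm z)%:O + 1%:O = 2 *: E.
  by rewrite EE nE; cay_lin.
split; first by have := siegel_domain_neq0 hS; rewrite E2 two_scale_eq0.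
rewrite (siegel_inv_fin hS) E2 cayinvZ two_half scale1r.
by rewrite (caymulZr 2^-1) two_half.
Qed.

Lemma flow_origin y z : cayconj y = - y -> flow y z 1 (PFin 0 0) = u_origin y z.
Proof.
move=> yE; have h0 : hplane (0 : cay R, 0 : cay R).
  by rewrite /hplane /= !caymod2 caynorm0 addr0 ltr01.
have [//||] := @flowE y z 0 0 1%:O (1%:O + ((caynorm z / 2)%:O + y)) yE h0.
- by rewrite subr0 cayinv1.
- by rewrite caymul0l caymul0r addr0.
rewrite caymul0l add0r /u_origin caymod2.
move: (_ + y) => q E0 ->; congr PFin.
have -> : q = 1%:O + q - 1%:O by rewrite addrC addKr.
rewrite [1%:O + (_ - _)]addrC subrK; move: (1%:O + q) E0 => E E0.
by cay_expand; rewrite caymulV.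
Qed.

(** With [a = 1 - x1] and [r = |a|^2], the factor [w] is the conjugate of [a], that is [r a^-1].
    Hence [m = (conj z (x2 a^-1)) a] and [D = r E] with [E] from [flowE]; the factor [r] cancels
    between numerators and [D]. *)
Lemma flow_closed_form y z x1 x2 : cayconj y = - y -> hplane (x1, x2) ->
  let h : cay R := (caymod z ^+ 2 / 2)%:O in
  let w : cay R := 1%:O - cayconj x1 in
  let m : cay R := (cayconj z *o (x2 *o w)) *o cayinv w in
  let D : cay R := (- ((h + y) *o x1) + m + 1%:O + h + y) *o w in
  flow y z 1 (PFin x1 x2) =
  PFin ((((1%:O - h - y) *o x1 + m + h + y) *o w) *o cayinv D)
      (((- (z *o x1) + x2 + z) *o w) *o cayinv D).
Proof.
move=> yE hp h w m D.
have hE : h = (caynorm z / 2)%:O by rewrite /h caymod2.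
clearbody h.
have a0 := hplane_neq1 hp.
have [a aE] : exists a, a = 1%:O - x1 by eexists.
have x1E : x1 = 1%:O - a by rewrite aE subKr.
have an0 : a != 0 by rewrite aE.
have [r rE] : exists r, r = caynorm a by eexists.
have r0 : r != 0 by rewrite rE caynorm_eq0.
have [i iE] : exists i : cay R, i = cayinv a by eexists.
have [t tE] : exists t : cay R, t = cayconj z *o (x2 *o i) by eexists.
have wE : w = r *: i.
  rewrite iE /cayinv scalerA rE mulfV -?rE// scale1r aE.
  by rewrite cayconjD cayconjN cayconjO.
have mE : m = t *o a.
  rewrite /m wE cayinvZ tE iE cayinvK !(caymulZr r) (caymulZl r).
  by rewrite (caymulZr r^-1) scalerA mulfV ?scale1r.
have [E EE] : exists E : cay R, E = i + t + (h + y) by eexists.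
have [||E0 ->] := @flowE y z x1 x2 i E yE hp.
- by rewrite iE aE.
- by rewrite EE tE hE.
have ti : (t *o a) *o i = t by rewrite iE cayKVr.
have ai : a *o i = 1%:O by rewrite iE caymulV.
have qi : ((h + y) *o a) *o i = h + y by rewrite iE cayKVr.
have zi : (z *o a) *o i = z by rewrite iE cayKVr.
have DE : D = r *: E.
  rewrite /D wE mE EE x1E.
  have -> : - ((h + y) *o (1%:O - a)) + t *o a + 1%:O + h + y =
    (h + y) *o a + t *o a + 1%:O by cay_bilin.
  by rewrite (caymulZr r) 2!(caymulDl _ _ i) ti qi caymul1l; congr (_ *: _);
      cay_lin.
have rV (u : cay R) v : (r *: u) *o (r^-1 *: v) = u *o v.
  by rewrite (caymulZl r) (caymulZr r^-1) scalerA mulfV ?scale1r.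
rewrite DE cayinvZ wE mE x1E; congr PFin; rewrite (caymulZr r) rV.
  have -> : (1%:O - h - y) *o (1%:O - a) + t *o a + h + y =
    (h + y) *o a + t *o a + 1%:O - a by cay_bilin.
  rewrite 3!(caymulDl _ _ i) caymulNl ti qi ai caymul1l.
  have -> : h + y + t + i - 1%:O = E - 1%:O by rewrite EE; cay_lin.
  by cay_expand; rewrite caymulV.
have -> : - (z *o (1%:O - a)) + x2 + z = z *o a + x2 by cay_bilin.
by rewrite (caymulDl _ _ i) zi [z + _]addrC.
Qed.

End Existence.

(** * Root vectors in the Siegel chart *)

Section ChartFields.
Variable R : realType.
Implicit Types (x y z u v w c X Y U : cay R) (k l s t : R).
Implicit Types (V : cay R * cay R -> cay R * cay R).

Definition ball_point X Y : cay R * cay R :=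
  (1%:O - 2 *: cayinv (Y + 1%:O), 2 *: (X *o cayinv (Y + 1%:O))).

(* In the Siegel chart the field [V] has the components [pushX V] and
   [2 *: pushY V]; here [i = (Y + 1) / 2 = (1 - x1)^-1]. *)
Definition pushY V X Y : cay R :=
  let i := 2^-1 *: (Y + 1%:O) in (i *o (V (ball_point X Y)).1) *o i.

Definition pushX V X Y : cay R :=
  (V (ball_point X Y)).2 *o (2^-1 *: (Y + 1%:O)) +
  (ball_point X Y).2 *o pushY V X Y.

Lemma siegel_inv_ball X Y : siegel_domain (PFin X Y) ->
  siegel_inv (PFin X Y) = PFin (ball_point X Y).1 (ball_point X Y).2.
Proof. exact: siegel_inv_fin. Qed.

Lemma hplane_ball X Y : siegel_domain (PFin X Y) -> hplane (ball_point X Y).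
Proof.
move=> h; have := siegel_inv_ball h; case: (ball_point X Y) => x1 x2 e.
by apply/siegel_hplane; rewrite -[PFin x1 x2]e siegel_invK.
Qed.

Lemma siegel_domain_fin p : siegel_domain (siegel p) ->
  exists x1 x2, p = PFin x1 x2 /\ 1%:O - x1 != 0.
Proof.
case: p => [x y|u|] //=.
  have [->|x1] /= := eqVneq x 1%:O; first by case: eqVneq.
  by move=> _; exists x, y; split=> //; rewrite subr_eq0 eq_sym.
rewrite !mxE /= mulr1 => h; have := caynorm_ge0 (- u) => h'; lra.
Qed.

Lemma is_derive_chart (f g : R -> cay R) t df dg :
  1%:O - f t != 0 -> is_derive t 1 f df -> is_derive t 1 g dg ->
  let i := cayinv (1%:O - f t) in
  is_derive t (1 : R) (fun s => cayinv (1%:O - f s)) ((i *o df) *o i) /\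
  is_derive t (1 : R) (fun s => g s *o cayinv (1%:O - f s))
    (dg *o i + g t *o ((i *o df) *o i)).
Proof.
move=> f1 hf hg i.
have hi : is_derive t (1 : R) (fun s => cayinv (1%:O - f s)) ((i *o df) *o i).
  have ha := is_deriveB (is_derive_cst 1%:O t (1 : R)) hf.
  apply: is_derive_eq (is_derive_inv f1 ha) _.
  by rewrite sub0r caymulNr caymulNl opprK.
by split=> //; exact: is_derive_mul.
Qed.

Definition siegel_conj (g : plane R -> plane R) : plane R -> plane R :=
  @siegel R \o g \o @siegel_inv R.

Lemma siegel_conjE g p : siegel_conj g p = siegel (g (siegel_inv p)).
Proof. by []. Qed.

Definition sX (f : R -> plane R -> plane R) q s : cay R :=
  (coords (siegel_conj (f s) q)).1.
Definition sY (f : R -> plane R -> plane R) q s : cay R :=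
  (coords (siegel_conj (f s) q)).2.

Section OneFlow.
Variables (f : R -> plane R -> plane R) (V : cay R * cay R -> cay R * cay R).
Hypotheses (fG : one_param_subgroup f) (fV : generator f V).

Lemma siegelG_conj s : siegelG (siegel_conj (f s)).
Proof. by apply: autG_siegel; have [] := fG. Qed.

Lemma domain_flow q s : siegel_domain q -> siegel_domain (siegel_conj (f s) q).
Proof. by apply: siegel_domainG; exact: siegelG_conj. Qed.

Lemma siegel_conj_fin X Y s : siegel_domain (PFin X Y) ->
  siegel_conj (f s) (PFin X Y) = PFin (sX f (PFin X Y) s) (sY f (PFin X Y) s).
Proof.
move=> /(@domain_flow _ s); rewrite /sX /sY.
by case: siegel_conj => [X' Y'|u|].
Qed.

(** Additivity makes [f 0] idempotent, and an injective idempotent map is the identity. *)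
Lemma flow0 q : siegel_conj (f 0) q = q.
Proof.
have [[g' gK g'K] _] := (siegelG_conj 0).1.
have fD : siegel_conj (f 0) (siegel_conj (f 0) q) = siegel_conj (f 0) q.
  rewrite !siegel_conjE siegelK; congr siegel.
  by have [_ /(_ 0 0)] := fG; rewrite addr0 => {3}->.
by rewrite -[LHS]gK fD gK.
Qed.

Lemma sX0 X Y : sX f (PFin X Y) 0 = X.
Proof. by rewrite /sX flow0. Qed.

Lemma sY0 X Y : sY f (PFin X Y) 0 = Y.
Proof. by rewrite /sY flow0. Qed.

Lemma is_derive_flow0 X Y : siegel_domain (PFin X Y) ->
  is_derive (0 : R) (1 : R) (sX f (PFin X Y)) (pushX V X Y) /\
  is_derive (0 : R) (1 : R) (sY f (PFin X Y)) (2 *: pushY V X Y).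
Proof.
move=> qS; have hp := hplane_ball qS.
have hc := fV hp.
set c := (fun s => _) in hc.
have cE s : 1%:O - (c s).1 != 0 /\ siegel_conj (f s) (PFin X Y) =
    PFin ((c s).2 *o cayinv (1%:O - (c s).1))
         (2 *: cayinv (1%:O - (c s).1) - 1%:O).
  have := @domain_flow _ s qS; rewrite siegel_conjE (siegel_inv_ball qS).
  move=> /siegel_domain_fin[x1 [x2 [e x11]]].
  by rewrite /c e (siegel_fin _ x11).
have c0 : c 0 = ball_point X Y.
  have := flow0 (PFin X Y); rewrite siegel_conjE (siegel_inv_ball qS).
  move=> /(congr1 (@siegel_inv R)); rewrite siegelK (siegel_inv_ball qS).
  by rewrite /c /= => ->.
have i0 : cayinv (1%:O - (c 0).1) = 2^-1 *: (Y + 1%:O).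
  by rewrite c0 /= subKr cayinvZ cayinvK.
have [hi hX] := is_derive_chart (cE 0).1 (is_derive_fst hc) (is_derive_snd hc).
split.
  rewrite (_ : sX _ _ = fun s => (c s).2 *o cayinv (1%:O - (c s).1)); last
      first.
    by apply/funext => s; rewrite /sX (cE s).2.
  by apply: is_derive_eq hX _; rewrite i0 /pushX /pushY -c0.
rewrite (_ : sY _ _ = (2 \*: (fun s => cayinv (1%:O - (c s).1))) - cst 1%:O);
    last first.
  by apply/funext => s; rewrite /sY (cE s).2.
apply: is_derive_eq (is_deriveB (is_deriveZ 2 hi) (is_derive_cst 1%:O 0 (1 :
    R))) _.
by rewrite subr0 i0.
Qed.

(** By the group law, the velocity at time [t] is the velocity at time 0 from the point reached at
    [t]. *)
Lemma is_derive_flow X Y t : siegel_domain (PFin X Y) ->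
  let q := PFin X Y in
  is_derive t (1 : R) (sX f q) (pushX V (sX f q t) (sY f q t)) /\
  is_derive t (1 : R) (sY f q) (2 *: pushY V (sX f q t) (sY f q t)).
Proof.
move=> qS q; have := @domain_flow _ t qS.
rewrite siegel_conj_fin// => /is_derive_flow0[hX hY].
have E h : siegel_conj (f (h *: (1 : R) + t)) q =
    siegel_conj (f h) (PFin (sX f q t) (sY f q t)).
  rewrite -siegel_conj_fin// !siegel_conjE siegelK; congr siegel.
  by rewrite [h *: _]mulr1; have [_ ->] := fG.
split; apply/is_derive_lineP.
  by rewrite (_ : (fun h => _) = sX f (PFin (sX f q t) (sY f q t)))//;
    apply/funext => h; rewrite /sX E.
by rewrite (_ : (fun h => _) = sY f (PFin (sX f q t) (sY f q t)))//;
  apply/funext => h; rewrite /sY E.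
Qed.

End OneFlow.
End ChartFields.

(** * Homogeneity of root vectors under dilations *)

Section Homogeneity.
Variable R : realType.
Implicit Types (x y z u v w c X Y U : cay R) (k l s t : R).
Implicit Types (V : cay R * cay R -> cay R * cay R).

Lemma siegel_domain_dilation X Y k : k != 0 ->
  siegel_domain (PFin X Y) -> siegel_domain (PFin (k *: X) (k ^+ 2 *: Y)).
Proof.
move=> k0 /= h; rewrite caynormZ caycoordZ ltr_pM2l// lt_def sqrf_eq0 k0.
exact: sqr_ge0.
Qed.

Lemma is_derive_expRM k t :
  is_derive t (1 : R) (fun s => expR (k * s)) (k * expR (k * t)).
Proof.
have hk : is_derive t (1 : R) (fun s => k * s) k.
  apply: is_derive_eq (is_deriveZ k (is_derive_id t (1 : R))) _.
  by rewrite /GRing.scale /= mulr1.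
apply: is_derive_eq (is_derive1_comp (is_derive_expR (k * t)) hk) _.
by rewrite mulrC.
Qed.

Lemma is_derive_expR_sqr t :
  is_derive t (1 : R) (fun s => expR s ^+ 2) (2 * expR t ^+ 2).
Proof.
have -> : (fun s : R => expR s ^+ 2) = expR * expR by apply/funext.
apply: is_derive_eq (is_deriveM (is_derive_expR t) (is_derive_expR t)) _.
by rewrite /GRing.scale /=; ring.
Qed.

(* In the Siegel chart the flow of [fieldX] is [(e^t X, e^(2t) Y)]. *)
Lemma is_derive_dilation X Y t : siegel_domain (PFin X Y) ->
  is_derive t (1 : R)
    (fun s => ball_point (expR s *: X) (expR s ^+ 2 *: Y))
    (fieldX (ball_point (expR t *: X) (expR t ^+ 2 *: Y))).
Proof.
move=> qS.
have Y0 s : expR s ^+ 2 *: Y + 1%:O != 0.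
  have := siegel_domain_dilation (lt0r_neq0 (expR_gt0 s)) qS.
  exact: siegel_domain_neq0.
have h1 : is_derive t (1 : R) (fun s => expR s *: X) (expR t *: X).
  apply: is_derive_eq (is_derive_scale (is_derive_expR t) (is_derive_cst X t (1
      : R))) _.
  by rewrite scaler0 addr0.
have h2 : is_derive t (1 : R) (fun s => expR s ^+ 2 *: Y + 1%:O) (2 *: (expR t
    ^+ 2 *: Y)).
  apply: is_derive_eq (is_deriveD
    (is_derive_scale (is_derive_expR_sqr t) (is_derive_cst Y t (1 : R)))
        (is_derive_cst 1%:O t (1 : R))) _.
  by rewrite scaler0 !addr0 scalerA.
have hj := is_derive_inv (Y0 t) h2.
apply: is_derive_eq (is_derive_pair
  (is_deriveB (is_derive_cst 1%:O t (1 : R)) (is_deriveZ 2 hj))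
  (is_deriveZ 2 (is_derive_mul h1 hj))) _.
rewrite fieldXE /ball_point /=.
have [Yt YtE] : exists Yt, Yt = expR t ^+ 2 *: Y by eexists.
move: (Y0 t); rewrite -YtE; set j0 := Yt + 1%:O => j00.
have -> : Yt = j0 - 1%:O by rewrite /j0 addrK.
clearbody j0; move: (expR t *: X) => Xt {YtE Y0 hj h1 h2}.
have e1 : (cayinv j0 *o j0) = 1%:O by rewrite caymulVl.
have [j jE] : exists j, j = cayinv j0 by eexists.
rewrite -!jE in e1 *.
congr pair; cay_expand; rewrite e1; cay_expand.
  by cay_lin.
have e2 u : (u *o j) *o j = u *o (j *o j) by exact: cayaltr.
by rewrite e2; cay_lin.
Qed.

Section RootSpace.
Variables (k : R) (V : cay R * cay R -> cay R * cay R).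
Hypothesis (Vk : root_space k V).

(** The eigenvalue equation solved for the derivative of [V] along [fieldX], ready for the chain
    rule along a dilation orbit. *)
Lemma root_space_derive p : hplane p ->
  'D_(fieldX p) V p =
  (- (V p).1 *o p.1 - p.1 *o (V p).1 - k *: (V p).1,
   - (V p).2 *o p.1 - p.2 *o (V p).1 - k *: (V p).2).
Proof.
move=> hp; have [_ /(_ p hp)] := Vk.
rewrite /ad; have [_ ->] := derive_fieldX p (V p).
move=> h; rewrite -[LHS](subKr (- ((V p).1 *o p.1 + p.1 *o (V p).1),
  - ((V p).2 *o p.1 + p.2 *o (V p).1))) h.
by congr pair; rewrite /= caymulNl opprD.
Qed.

(** The weight 1 of the coordinate [X] under dilations and the eigenvalue [k] combine to the factor
    [1 - k]. *)
Lemma is_derive_pushX_dilation X Y t : siegel_domain (PFin X Y) ->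
  is_derive t (1 : R) (fun s => pushX V (expR s *: X) (expR s ^+ 2 *: Y))
    ((1 - k) *: pushX V (expR t *: X) (expR t ^+ 2 *: Y)).
Proof.
move=> qS.
have qtS := siegel_domain_dilation (lt0r_neq0 (expR_gt0 t)) qS.
have hp := hplane_ball qtS.
have hc := is_derive_dilation t qS.
have Vd : differentiable V (ball_point (expR t *: X) (expR t ^+ 2 *: Y)).
  by have [[_ /(_ _ hp)]] := Vk.
have hV := is_derive_chain Vd hc.
rewrite (root_space_derive hp) in hV.
have hV1 := is_derive_fst hV; have hV2 := is_derive_snd hV.
have hx2 := is_derive_snd hc.
have hi : is_derive t (1 : R) (fun s => 2^-1 *: (expR s ^+ 2 *: Y + 1%:O))
    (expR t ^+ 2 *: Y).
  apply: is_derive_eq (is_deriveZ 2^-1 (is_deriveD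
    (is_derive_scale (is_derive_expR_sqr t) (is_derive_cst Y t (1 : R)))
        (is_derive_cst 1%:O t (1 : R)))) _.
  by rewrite scaler0 !addr0 scalerA mulrA mulVf ?mul1r.
have hP := is_derive_mul (is_derive_mul hi hV1) hi.
apply: is_derive_eq (is_deriveD (is_derive_mul hV2 hi) (is_derive_mul hx2 hP))
    _.
rewrite fieldXE /pushX /pushY.
have [bp bE] : exists bp, bp = ball_point (expR t *: X) (expR t ^+ 2 *: Y) by
    eexists.
rewrite -!bE.
(* Everything is expressed through [i], the inverse of [1 - x1] at the moving point; the
   cancellations [F1] to [F4] then leave a linear identity. *)
have [i iE] : exists i, i = 2^-1 *: (expR t ^+ 2 *: Y + 1%:O) by eexists.
have -> : expR t ^+ 2 *: Y = 2 *: i - 1%:O by rewrite iE two_half addrK.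
have -> : 2^-1 *: (2 *: i - 1%:O + 1%:O) = i by rewrite subrK half2.
have i0 : i != 0.
  by rewrite iE scaler_eq0 invr_eq0 pnatr_eq0 /=; exact: siegel_domain_neq0 qtS.
have b1 : bp.1 = 1%:O - cayinv i by rewrite bE /= iE cayinvZ invrK.
rewrite b1 /= {hP hi hx2 hV2 hV1 hV Vd hc hp bE b1}.
move: bp.2 (V bp) => x2 [v1 v2] /=.
have F1 : (v2 *o cayinv i) *o i = v2 by rewrite cayVKr.
have F2 : (i *o (v1 *o cayinv i)) *o i = i *o v1 by rewrite cayflex cayVKr.
have F3 : i *o (cayinv i *o v1) = v1 by rewrite cayKVl.
have F4 : (x2 *o cayinv i) *o ((i *o v1) *o i) = (x2 *o v1) *o i.
  by rewrite -caymoufangr cayVKr.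
move: (cayinv i) F1 F2 F3 F4 => a F1 F2 F3 F4.
by cay_expand; rewrite F1 F2 F3 F4; cay_lin.
Qed.

Lemma pushX_dilation X Y t : siegel_domain (PFin X Y) ->
  expR ((k - 1) * t) *: pushX V (expR t *: X) (expR t ^+ 2 *: Y) = pushX V X Y.
Proof.
move=> qS.
have h s : is_derive s (1 : R) (fun s =>
    expR ((k - 1) * s) *: pushX V (expR s *: X) (expR s ^+ 2 *: Y)) 0.
  apply: is_derive_eq (is_derive_scale (is_derive_expRM (k - 1) s)
    (is_derive_pushX_dilation s qS)) _.
  by rewrite scalerA -scalerDl (_ : _ + _ = 0) ?scale0r//; ring.
by have := is_derive_cst_eq0 h t 0; rewrite mulr0 expR0 expr1n !scale1r.
Qed.

End RootSpace.

End Homogeneity.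

(** * The [X]-component of a root vector is constant *)

Section ConstantPushX.
Variable R : realType.
Implicit Types (x y z u v w c X Y U : cay R) (k l s t : R).

Lemma near_neq0 (f : R -> cay R) t df : is_derive t (1 : R) f df ->
  f t != 0 -> \forall s \near t, f s != 0.
Proof.
move=> /is_derive_continuous fc ft0.
have nf : 0 < `|f t| by rewrite normr_gt0.
move: fc => /cvgrPdist_lt/(_ _ nf); apply: filterS => s h.
by apply/eqP => fs0; move: h; rewrite fs0 subr0 ltxx.
Qed.

(** Dilation factors are positive, so limits at 0 are taken from the right; the derivative supplies
    continuity. *)
Lemma is_derive_right_cst (f : R -> cay R) df K : is_derive (0 : R) (1 : R) f
    df ->
  (\forall s \near 0^'+, f s = K) -> f 0 = K.
Proof.
move=> /is_derive_continuous fc fK.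
have h0 : f s @[s --> 0^'+] --> f 0 by exact: cvg_at_right_filter.
have hK : f s @[s --> 0^'+] --> K by exact: cvg_near_cst.
exact: (cvg_unique (@norm_hausdorff _ _) h0 hK).
Qed.

(** Collinearity is expressed by the inverse slope, which is 0 on vertical lines and so remains
    usable near them. *)
Lemma collinear_coslope L X1 Y1 X2 Y2 X3 Y3 : is_line L ->
  L (PFin X1 Y1) -> L (PFin X2 Y2) -> L (PFin X3 Y3) -> Y2 - Y1 != 0 ->
  X3 - X1 = ((X2 - X1) *o cayinv (Y2 - Y1)) *o (Y3 - Y1).
Proof.
move=> [[u [v ->]]|[c ->]|->] //= => [-> -> ->|-> -> -> _]; last first.
  by rewrite subrr !caymul0l.
have e X X' : u *o X + v - (u *o X' + v) = u *o (X - X') by cay_bilin.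
rewrite !e caymul_eq0 negb_or => /andP[u0 X0].
by rewrite cayinvM cayKVl// cayVKl.
Qed.

Section RootSpace.
Variables (n : nat) (V : cay R * cay R -> cay R * cay R).
Hypothesis (Vn : root_space n.+1%:R V).

(** Dilation by time [ln k]. The eigenvalue is [n.+1], so the degree is [-n]; the roots of [N] are
    [n = 0] and [n = 1]. *)
Lemma pushX_scale X Y k : 0 < k -> siegel_domain (PFin X Y) ->
  k ^+ n *: pushX V (k *: X) (k ^+ 2 *: Y) = pushX V X Y.
Proof.
move=> k0 qS; have := pushX_dilation Vn (ln k) qS.
by rewrite -natr1 addrK expRM_natl lnK.
Qed.

(** The flow keeps the three points of a vertical line collinear. [collinear_coslope] is
    differentiated at time 0, where the inverse slope vanishes, so only its own derivative
    contributes. *)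
Lemma pushX_affine c Y1 Y2 Y3 : siegel_domain (PFin c Y1) ->
  siegel_domain (PFin c Y2) -> siegel_domain (PFin c Y3) -> Y2 - Y1 != 0 ->
  pushX V c Y3 - pushX V c Y1 =
  ((pushX V c Y2 - pushX V c Y1) *o cayinv (Y2 - Y1)) *o (Y3 - Y1).
Proof.
move=> q1 q2 q3 Y21.
have [[[f fG fV] _] _] := Vn.
have [h1X h1Y] := is_derive_flow0 fG fV q1.
have [h2X h2Y] := is_derive_flow0 fG fV q2.
have [h3X h3Y] := is_derive_flow0 fG fV q3.
have h21Y := is_deriveB h2Y h1Y.
have h31Y := is_deriveB h3Y h1Y.
have s21 : sY f (PFin c Y2) 0 - sY f (PFin c Y1) 0 != 0 by rewrite !sY0.
have hR := is_derive_mul (is_derive_mul (is_deriveB h2X h1X)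
  (is_derive_inv s21 h21Y)) h31Y.
have hL := is_deriveB h3X h1X.
have near_eq : \forall s \near (0 : R), (sX f (PFin c Y3) - sX f (PFin c Y1)) s
    =
  ((sX f (PFin c Y2) - sX f (PFin c Y1)) s *o
   cayinv ((sY f (PFin c Y2) - sY f (PFin c Y1)) s)) *o
  (sY f (PFin c Y3) - sY f (PFin c Y1)) s.
  have := near_neq0 h21Y s21; apply: filterS => s sn0.
  have [[_ gl] _] := siegelG_conj fG s.
  have lL : is_line (siegel_conj (f s) @` line1 c) by apply/gl/Or32; exists c.
  apply: (collinear_coslope lL) => //; rewrite -siegel_conj_fin//; exact:
      imageP.
have := is_derive_unique (near_eq_is_derive near_eq hL) hR.
rewrite !fctE !sX0// !sY0//.
by rewrite (subrr c) !caymul0l !addr0.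
Qed.

Lemma siegel_domain_real X k : caynorm X < k -> siegel_domain (PFin X k%:O).
Proof. by rewrite /siegel_domain !mxE /= mulr1. Qed.

Lemma near_right_small X :
  \forall k \near 0^'+, 0 < (k : R) /\ caynorm (k *: X) < 1.
Proof.
have N0 := caynorm_ge0 X.
near=> k; have k0 : 0 < k by near: k; exact: nbhs_right_gt.
split=> //; rewrite caynormZ.
have k1 : k < 1 by near: k; exact: nbhs_right_lt.
have kN : k < (1 + caynorm X)^-1.
  by near: k; apply: nbhs_right_lt; rewrite invr_gt0 ltr_pwDl.
have : k * (1 + caynorm X) < 1 by rewrite -ltr_pdivlMr ?div1r// ltr_pwDl.
have : k ^+ 2 * caynorm X <= k * caynorm X.
  by rewrite ler_wpM2r// expr2 ler_piMl// ltW.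
lra.
Unshelve. all: by end_near. Qed.

Lemma derivable_pushX c Y : siegel_domain (PFin 0 Y) ->
  exists d, is_derive (0 : R) (1 : R) (fun k => pushX V (k *: c) Y) d.
Proof.
move=> qS; have hp := hplane_ball qS.
have hk : is_derive (0 : R) (1 : R) (fun k => k *: c) c.
  have := is_derive_affine 0 c 0.
  by under eq_fun do rewrite add0r.
have hcst x := is_derive_cst x (0 : R) (1 : R).
have hx2 := is_deriveZ 2 (is_derive_mul hk (hcst (cayinv (Y + 1%:O)))).
have hc : is_derive (0 : R) (1 : R) (fun k => ball_point (k *: c) Y) _ :=
  is_derive_pair (hcst (1%:O - 2 *: cayinv (Y + 1%:O))) hx2.
have Vd : differentiable V (ball_point (0 *: c) Y).
  by rewrite scale0r; have [[_ /(_ _ hp)]] := Vn.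
have hV := is_derive_chain Vd hc.
pose i := 2^-1 *: (Y + 1%:O).
eexists; exact: is_deriveD (is_derive_mul (is_derive_snd hV) (hcst i))
  (is_derive_mul hx2
    (is_derive_mul (is_derive_mul (hcst i) (is_derive_fst hV)) (hcst i))).
Qed.

(** After dilation by a small [k], affinity measures the difference against the ordinates 1 and 2 at
    abscissa [k c]. By homogeneity the difference equals [k^(n+2)] times a quantity continuous at
    [k = 0], so it vanishes. *)
Lemma pushX_vertical c Y1 Y2 : siegel_domain (PFin c Y1) ->
  siegel_domain (PFin c Y2) -> pushX V c Y1 = pushX V c Y2.
Proof.
move=> q1 q2.
have d1 : siegel_domain (PFin (0 : cay R) 1%:O) by apply: siegel_domain_real;
    rewrite caynorm0.
have d2 : siegel_domain (PFin (0 : cay R) 2%:O).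
  by apply: siegel_domain_real; rewrite caynorm0 ltr0n.
have [e1 h1] := derivable_pushX c d1.
have [e2 h2] := derivable_pushX c d2.
(* The exponent is [n] from the homogeneity of [pushX] plus 2 from the scaling of [Y]. *)
have hpow := is_derive_pow n.+2 (0 : R).
have := is_derive_right_cst (K := pushX V c Y2 - pushX V c Y1) (is_derive_scale
    hpow
  (is_derive_mul (is_deriveB h2 h1) (is_derive_cst (Y2 - Y1) (0 : R) (1 : R)))).
rewrite expr0n scale0r => /(_ _)/esym/eqP; rewrite subr_eq0 => /(_ _)/eqP -> //.
apply: filterS (near_right_small c) => k [k0 kc].
have dk1 : siegel_domain (PFin (k *: c) 1%:O) by exact: siegel_domain_real.
have dk2 : siegel_domain (PFin (k *: c) 2%:O).
  by apply: siegel_domain_real; rewrite (lt_trans kc)// ltr1n.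
have Y21 : 2%:O - 1%:O = 1%:O :> cay R by rewrite (cayrealE 2); cay_lin.
have Y210 : 2%:O - 1%:O != 0 :> cay R by rewrite Y21 cay1_neq0.
have A1 := pushX_affine dk1 dk2 (siegel_domain_dilation (lt0r_neq0 k0) q1) Y210.
have A2 := pushX_affine dk1 dk2 (siegel_domain_dilation (lt0r_neq0 k0) q2) Y210.
rewrite -(pushX_scale k0 q1) -(pushX_scale k0 q2) -scalerBr.
rewrite Y21 cayinv1 caymul1r in A1 A2.
have -> : pushX V (k *: c) (k ^+ 2 *: Y2) - pushX V (k *: c) (k ^+ 2 *: Y1) =
    (pushX V (k *: c) 2%:O - pushX V (k *: c) 1%:O) *o (k ^+ 2 *: (Y2 - Y1)).
  have -> : k ^+ 2 *: (Y2 - Y1) = k ^+ 2 *: Y2 - 1%:O - (k ^+ 2 *: Y1 - 1%:O).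
    by cay_lin.
  by rewrite caymulDr caymulNr -A1 -A2 opprB addrA subrK.
by rewrite caymulZr scalerA -exprD addn2.
Qed.

(** Homogeneity and independence of [Y] give [k^n pushX V (k c) 1] for small [k > 0]; then [k] tends
    to 0. The factor [0 ^+ n] is 1 for [n = 0] and 0 otherwise. *)
Lemma pushX_const c Y : siegel_domain (PFin c Y) ->
  pushX V c Y = 0 ^+ n *: pushX V 0 1%:O.
Proof.
move=> qS.
have d1 : siegel_domain (PFin (0 : cay R) 1%:O) by apply: siegel_domain_real;
    rewrite caynorm0.
have [e1 h1] := derivable_pushX c d1.
have hpow := is_derive_pow n (0 : R).
have := is_derive_right_cst (K := pushX V c Y) (is_derive_scale hpow h1).
rewrite scale0r => ->//.
apply: filterS (near_right_small c) => k [k0 kc].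
rewrite -(pushX_scale k0 qS); congr (_ *: _); apply: pushX_vertical.
  exact: siegel_domain_real.
exact: (siegel_domain_dilation (lt0r_neq0 k0) qS).
Qed.

End RootSpace.
End ConstantPushX.

(** * The [Y]-component of a root vector is affine in [X] *)

Section AffinePushY.
Variable R : realType.
Implicit Types (x y z u v w c X Y U : cay R) (k l s t : R).

(* The vertical line of abscissa [conj w / 2] is the polar of the point at
   infinity [w] of the lines of slope [w].  For the image [X = P Y + Q] of the
   former and the image [Y = u X + v] of one of the latter, this incidence
   reads [conj Q = u / 2 + v conj P]. *)
Lemma polar_incidence g w v q1 q2 r1 r2 X1 Y1 X2 Y2 U1 V1 U2 V2 :
  siegelG g ->
  line1 (2^-1 *: cayconj w) q1 -> line1 (2^-1 *: cayconj w) q2 ->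
  line2 w v r1 -> line2 w v r2 ->
  g q1 = PFin X1 Y1 -> g q2 = PFin X2 Y2 ->
  g r1 = PFin U1 V1 -> g r2 = PFin U2 V2 ->
  Y2 - Y1 != 0 -> U2 - U1 != 0 ->
  let P := (X2 - X1) *o cayinv (Y2 - Y1) in
  let u := (V2 - V1) *o cayinv (U2 - U1) in
  cayconj (X1 - P *o Y1) = 2^-1 *: u + (V1 - u *o U1) *o cayconj P.
Proof.
move=> [[_ gl] gp] Lq1 Lq2 Mr1 Mr2 gq1 gq2 gr1 gr2 Y21 U21.
have pq q : line1 (2^-1 *: cayconj w) q -> siegel_polarity (g (PInf w)) (g q).
  by move=> Lq; rewrite -gp; exact: imageP.
have Mg q : line2 w v q -> (g @` line2 w v) (g q) by exact: imageP.
have := pq _ Lq1; have := pq _ Lq2; rewrite gq1 gq2.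
have := Mg _ Mr1; have := Mg _ Mr2; rewrite gr1 gr2.
have : (g @` line2 w v) (g (PInf w)) by exact: Mg.
have : is_line (g @` line2 w v) by apply/gl/Or31; do 2 eexists.
case=> [[u [v' ->]]|[c ->]|->] //=; last first.
  by move=> _ U2c U1c; move: U21; rewrite U2c U1c subrr eqxx.
move=> pM V2E V1E.
have -> : (V2 - V1) *o cayinv (U2 - U1) = u.
  rewrite V2E V1E; have -> : u *o U2 + v' - (u *o U1 + v') = u *o (U2 - U1).
    by cay_bilin.
  by rewrite cayKVr.
have -> : V1 - u *o U1 = v' by rewrite V1E addrC addKr.
(* If the pole goes to [(p, b)], the vertical line goes to [Y = 2 conj p X - conj b]; thus [P] is
   the inverse of [2 conj p], [Q = P conj b], and [b = u p + v'] gives the claim. If it goes to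
   infinity, the image is vertical and [P = 0]. *)
case: (g (PInf w)) pM => [p b|w'|] //= pM.
  move=> Y2E Y1E.
  have DE : Y2 - Y1 = 2 *: cayconj p *o (X2 - X1).
    by rewrite Y2E Y1E; cay_bilin.
  have := Y21; rewrite DE caymul_eq0 negb_or two_scale_eq0 cayconj_eq0.
  move=> /andP[p0 X21].
  have c0 : 2 *: cayconj p != 0 by rewrite two_scale_eq0 cayconj_eq0.
  rewrite cayinvM cayKVl// Y1E caymulDr cayVKl//.
  rewrite cayinvZ cayinv_conj opprD addrA subrr sub0r caymulNr opprK.
  rewrite (caymulZl 2^-1) !(cayconjZ 2^-1) cayconjM !cayconjK pM.
  by rewrite (caymulZr 2^-1) caymulDl cayKVr//; cay_lin.
move=> -> ->; rewrite subrr caymul0l cayconj0 caymul0r addr0 caymul0l subr0.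
by rewrite cayconjZ cayconjK pM.
Qed.

Section RootSpace.
Variables (n : nat) (V : cay R * cay R -> cay R * cay R).
Hypothesis (Vn : root_space n.+1%:R V).
Let z := 0 ^+ n *: pushX V 0 1%:O.

(** [polar_incidence] is differentiated at time 0 for the line joining the two points, of slope [w],
    and the vertical line with pole [PInf w]. Since [pushX] is the constant [z], the terms [P] and
    [P'] vanish, and [conj z = u' / 2] remains. *)
Lemma pushY_secant X1 Y1 X2 Y2 : siegel_domain (PFin X1 Y1) ->
  siegel_domain (PFin X2 Y2) -> X2 - X1 != 0 ->
  2 *: pushY V X2 Y2 - 2 *: pushY V X1 Y1 = 2 *: cayconj z *o (X2 - X1).
Proof.
move=> r1 r2 X21.
have [[[f fG fV] _] _] := Vn.
pose w := (Y2 - Y1) *o cayinv (X2 - X1).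
pose c := 2^-1 *: cayconj w.
(* Two points of the vertical line inside the domain, with ordinates differing by 1. *)
have q1 : siegel_domain (PFin c (caynorm c + 1)%:O).
  by apply: siegel_domain_real; rewrite ltrDl.
have q2 : siegel_domain (PFin c (caynorm c + 2)%:O).
  by apply: siegel_domain_real; rewrite ltrDl.
set Yq1 := cayreal _ in q1; set Yq2 := cayreal _ in q2.
have Yq21 : Yq2 - Yq1 != 0.
  have -> : Yq2 - Yq1 = 1%:O.
    by rewrite /Yq2 /Yq1 !cayrealD; cay_lin.
  exact: cay1_neq0.
clearbody Yq1 Yq2.
have [hq1X hq1Y] := is_derive_flow0 fG fV q1.
have [hq2X hq2Y] := is_derive_flow0 fG fV q2.
have [hr1X hr1Y] := is_derive_flow0 fG fV r1.
have [hr2X hr2Y] := is_derive_flow0 fG fV r2.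
rewrite (pushX_const Vn q1) -/z in hq1X.
rewrite (pushX_const Vn q2) -/z in hq2X.
rewrite (pushX_const Vn r1) -/z in hr1X.
rewrite (pushX_const Vn r2) -/z in hr2X.
have hqY := is_deriveB hq2Y hq1Y; have hrX := is_deriveB hr2X hr1X.
have sq : (sY f (PFin c Yq2) - sY f (PFin c Yq1)) 0 != 0.
  by rewrite !fctE !sY0.
have sr : (sX f (PFin X2 Y2) - sX f (PFin X1 Y1)) 0 != 0.
  by rewrite !fctE !sX0.
have hP := is_derive_mul (is_deriveB hq2X hq1X) (is_derive_inv sq hqY).
have hu := is_derive_mul (is_deriveB hr2Y hr1Y) (is_derive_inv sr hrX).
have hL := is_derive_conj (is_deriveB hq1X (is_derive_mul hP hq1Y)).
have hR := is_deriveD (is_deriveZ 2^-1 hu)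
  (is_derive_mul (is_deriveB hr1Y (is_derive_mul hu hr1X)) (is_derive_conj hP)).
have near_eq : \forall s \near (0 : R),
    cayconj ((sX f (PFin c Yq1) s - ((sX f (PFin c Yq2) - sX f (PFin c Yq1)) s
        *o
      cayinv ((sY f (PFin c Yq2) - sY f (PFin c Yq1)) s)) *o sY f (PFin c Yq1)
          s)) =
    2^-1 *: ((sY f (PFin X2 Y2) - sY f (PFin X1 Y1)) s *o
      cayinv ((sX f (PFin X2 Y2) - sX f (PFin X1 Y1)) s)) +
    (sY f (PFin X1 Y1) s - ((sY f (PFin X2 Y2) - sY f (PFin X1 Y1)) s *o
      cayinv ((sX f (PFin X2 Y2) - sX f (PFin X1 Y1)) s)) *o sX f (PFin X1 Y1)
          s) *o
    cayconj ((sX f (PFin c Yq2) - sX f (PFin c Yq1)) s *o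
      cayinv ((sY f (PFin c Yq2) - sY f (PFin c Yq1)) s)).
  apply: filterS2 (near_neq0 hqY sq) (near_neq0 hrX sr) => s sqn srn.
  apply: (@polar_incidence _ w (Y1 - w *o X1) (PFin c Yq1) (PFin c Yq2)
    (PFin X1 Y1) (PFin X2 Y2) _ _ _ _ _ _ _ _ (siegelG_conj fG s)) => //;
    rewrite ?siegel_conj_fin//=.
  - by rewrite addrC subrK.
  - have -> : Y2 = Y1 + w *o (X2 - X1) by rewrite /w cayVKr// addrC subrK.
    by cay_bilin.
have := is_derive_unique (near_eq_is_derive near_eq hL) hR.
rewrite !fctE !sX0// !sY0//.
rewrite !(subrr z, subrr c, caymul0l, caymul0r, oppr0, cayconj0, addr0, subr0).
by move=> ->; rewrite two_half cayVKr.
Qed.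

Lemma pushY_affine : exists v, forall X Y, siegel_domain (PFin X Y) ->
  2 *: pushY V X Y = (2 *: cayconj z) *o X + v.
Proof.
have d1 : siegel_domain (PFin (0 : cay R) 1%:O).
  by apply: siegel_domain_real; rewrite caynorm0.
have d2 : siegel_domain (PFin (1%:O : cay R) 2%:O).
  by apply: siegel_domain_real; rewrite caynormO expr1n ltr1n.
(* The secant formula needs distinct abscissas; for [X = 0] the comparison with [(0, 1)] passes
   through [(1, 2)]. *)
exists (2 *: pushY V 0 1%:O) => X Y qS; have [X0|X0] := eqVneq X 0.
  have n1 : 1%:O - 0 != 0 :> cay R by rewrite subr0 cay1_neq0.
  move: qS; rewrite X0 => qS.
  have h1 := pushY_secant d1 d2 n1; have h2 := pushY_secant qS d2 n1.
  rewrite caymul0r add0r; apply: oppr_inj.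
  by apply: (addrI (2 *: pushY V 1%:O 2%:O)); rewrite h1.
have := pushY_secant d1 qS; rewrite subr0 => /(_ X0) <-.
by rewrite subrK.
Qed.

End RootSpace.
End AffinePushY.

(** * Integration of the flow, uniqueness and the theorem *)

Section Uniqueness.
Variable R : realType.
Implicit Types (x y z u v w c X Y U : cay R) (k l s t : R).

Lemma pushYD (V W : cay R * cay R -> cay R * cay R) X Y :
  pushY (fun p => V p + W p) X Y = pushY V X Y + pushY W X Y.
Proof. by rewrite /pushY /= caymulDr caymulDl. Qed.

Lemma pushXD (V W : cay R * cay R -> cay R * cay R) X Y :
  pushX (fun p => V p + W p) X Y = pushX V X Y + pushX W X Y.
Proof. by rewrite /pushX pushYD /= caymulDr caymulDl addrACA. Qed.

(** The orbit satisfies [X' = z] and [Y' = 2 conj z X + v]. Inserting [X + t z] adds [2 t |z|^2] to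
    [Y'], which integrates to [|z|^2] at time 1. *)
Lemma root_flow f V W : root_space (1 : R) V -> root_space 2 W ->
  one_param_subgroup f -> generator f (fun p => V p + W p) ->
  exists z v, forall X Y, siegel_domain (PFin X Y) ->
  siegel_conj (f 1) (PFin X Y) =
  PFin (X + z) (Y + (2 *: (cayconj z *o X) + v) + (caynorm z)%:O).
Proof.
move=> V1 W2 fG fV.
have [v vE] := @pushY_affine _ 0 V V1.
have [w wE] := @pushY_affine _ 1 W W2.
have AV X Y qS := @pushX_const _ 0 V V1 X Y qS.
have AW X Y qS := @pushX_const _ 1 W W2 X Y qS.
(* Here [0 ^+ 0 = 1] and [0 ^+ 1 = 0]: the field [W] contributes only a constant to the
   [Y]-component. *)
rewrite expr0 scale1r in vE AV; rewrite expr1 scale0r in wE AW.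
move: (pushX V 0 1%:O) vE AV => z vE AV; exists z, (v + w) => X Y qS.
rewrite (siegel_conj_fin fG)//.
have qtS t : siegel_domain (PFin (sX f (PFin X Y) t) (sY f (PFin X Y) t)).
  by rewrite -siegel_conj_fin//; exact: domain_flow.
have dX t : is_derive t (1 : R) (sX f (PFin X Y)) z.
  have [h _] := is_derive_flow fG fV t qS.
  by apply: is_derive_eq h _; rewrite pushXD AV// AW// addr0.
have sXE t : sX f (PFin X Y) t = X + t *: z.
  have h s : is_derive s (1 : R) (sX f (PFin X Y) - (fun r => r *: z)) 0.
    apply: is_derive_eq (is_deriveB (dX s) (is_derive_scale
      (is_derive_id s (1 : R)) (is_derive_cst z s (1 : R)))) _.
    by rewrite scaler0 addr0 scale1r subrr.
  have := is_derive_cst_eq0 h t 0; rewrite !fctE sX0// scale0r subr0 => e;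
      rewrite -[X in X + _]e.
  by rewrite subrK.
have dY t : is_derive t (1 : R) (sY f (PFin X Y))
    (2 *: (cayconj z *o X) + (v + w) + (2 * t) *: (caynorm z)%:O).
  have [_ h] := is_derive_flow fG fV t qS.
  apply: is_derive_eq h _; rewrite pushYD scalerDr vE// wE// sXE.
  rewrite cayconj0 scaler0 caymul0l add0r.
  by rewrite (caymulZl 2) caymulDr (caymulZr t) cayconjmul; cay_lin.
have h s : is_derive s (1 : R) (sY f (PFin X Y) - ((fun r =>
    r *: (2 *: (cayconj z *o X) + (v + w))) + (fun r => r ^+ 2 *: (caynorm
        z)%:O))) 0.
  apply: is_derive_eq (is_deriveB (dY s) (is_deriveD
    (is_derive_scale (is_derive_id s (1 : R)) (is_derive_cst _ s (1 : R)))
    (is_derive_scale (is_derive_pow 2 s) (is_derive_cst _ s (1 : R))))) _.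
  by rewrite !scaler0 !addr0 scale1r expr1 subrr.
rewrite sXE scale1r; congr PFin.
have := is_derive_cst_eq0 h 1 0; rewrite !fctE sY0//.
rewrite expr1n expr0n !scale0r !scale1r addr0 subr0 => /eqP.
by rewrite subr_eq addrA => /eqP.
Qed.

(** The origin is [(0, 1)] in the chart. Comparing its images under [g] and [flow y z 1] identifies
    both parameters of [root_flow]. *)
Lemma groupN_flowE y z g : cayconj y = - y -> groupN g ->
  g (PFin 0 0) = u_origin y z ->
  forall x1 x2, hplane (x1, x2) -> g (PFin x1 x2) = flow y z 1 (PFin x1 x2).
Proof.
move=> yE [V [W [V1 W2 [f [fG fV <-]]]]] f0 x1 x2 hp.
have [z' [v fE]] := root_flow V1 W2 fG fV.
have E p : siegel (f 1 p) = siegel_conj (f 1) (siegel p).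
  by rewrite siegel_conjE siegelK.
have E' p : siegel (flow y z 1 p) = heis (1 *: z) (1 *: y) (siegel p).
  exact: siegel_invK.
have d1 : siegel_domain (PFin (0 : cay R) 1%:O).
  by apply: siegel_domain_real; rewrite caynorm0.
have s0 : siegel (PFin 0 0) = PFin 0 1%:O :> plane R.
  rewrite siegel_fin subr0 ?cay1_neq0// cayinv1 caymul0l.
  by congr PFin; cay_lin.
have := E (PFin 0 0); rewrite f0 -flow_origin// E' s0 fE//.
rewrite heis_flow expr1n !scale1r !caymul0r scaler0 !add0r => -[zE].
rewrite -{}zE in fE * => /addIr/addrI vE.
apply: (can_inj (@siegelK R)); rewrite E' E.
have /siegel_hplane := hp.
case: siegel => [X Y|//|//] qS; rewrite fE// heis_flow.
by rewrite expr1n !scale1r -vE -scalerDr.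
Qed.

End Uniqueness.

Theorem theorem4p2 (R : realType) (x1 x2 y z : cay R)
    (hx : hplane (x1, x2)) (hy : imcay y) :
  let h : cay R := (caymod z ^+ 2 / 2)%:O in
  let w : cay R := 1%:O - cayconj x1 in
  let m : cay R := (cayconj z *o (x2 *o w)) *o cayinv w in
  let D : cay R := (- ((h + y) *o x1) + m + 1%:O + h + y) *o w in
  uN y z (PFin x1 x2) =
  PFin ((((1%:O - h - y) *o x1 + m + h + y) *o w) *o cayinv D)
      (((- (z *o x1) + x2 + z) *o w) *o cayinv D).
Proof.
have yE := cayimcay hy.
have ex : exists g, [set g | groupN g /\ g (PFin 0 0) = u_origin y z] g.
  by exists (flow y z 1); split; [exact: groupN_flow|exact: flow_origin].
(* The flow shows that the set is inhabited, so [xget] returns one of its elements, not the default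
   [id]. *)
have [gN g0] : [set g | groupN g /\ g (PFin 0 0) = u_origin y z] (uN y z).
  exact: xgetPex ex.
move=> h w m D; rewrite (groupN_flowE yE gN g0 hx).
exact: flow_closed_form.
Qed.
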